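(* Let $g$ be the standard (round, constant sectional curvature $1$) metric on the sphere $S^6$. Then $(S^6,g)$ does not admit any harmonic complex structure: there is no almost complex structure $J$ on $S^6$ with $\Delta J=0$, where $\Delta$ is the Hodge-Laplace operator of $g$ on $TS^6$-valued $1$-forms.
   Context: An almost complex structure $J$ on a smooth manifold $M$ is a smooth section of $T^*M\otimes TM$ with $J^2=-1$ as an endomorphism $J:TM\to TM$; it is regarded as a $TM$-valued $1$-form. No compatibility between $J$ and the metric $g$ is assumed. Let $\nabla$ be the Levi-Civita connection of $g$, extended to $TM$-valued $p$-forms $\omega\in\Gamma(\wedge^pT^*M\otimes TM)$ by $$(\nabla_X\omega)(X_1,\dots,X_p)=\nabla_X(\omega(X_1,\dots,X_p))-\sum_j\omega(X_1,\dots,\nabla_XX_j,\dots,X_p).$$ Define $$d\omega(X_0,\dots,X_p)=\sum_{k=0}^p(-1)^k(\nabla_{X_k}\omega)(X_0,\dots,\hat X_k,\dots,X_p),$$ $$\delta\omega(X_1,\dots,X_{p-1})=-\sum_i(\nabla_{e_i}\omega)(e_i,X_1,\dots,X_{p-1}),$$ where $\{e_i\}$ is a local orthonormal frame and $\hat X_k$ means that $X_k$ is omitted; $\delta=0$ on $0$-forms. The Hodge-Laplace operator is $\Delta=d\delta+\delta d$. For $M$ compact, $J$ is called a harmonic complex structure (with respect to $g$) if $\Delta J=0$. *)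

(* Defs.v *)
From HB Require Import structures.
From mathcomp Require Import all_boot all_order all_algebra.
From mathcomp Require Import all_classical all_reals all_analysis.
Set Implicit Arguments.
Unset Strict Implicit.
Unset Printing Implicit Defensive.
Import Order.TTheory GRing.Theory Num.Theory.
Import numFieldNormedType.Exports.
Local Open Scope classical_set_scope.
Local Open Scope ring_scope.

(* The Euclidean inner product; the library norm on 'rV is the sup norm. *)
Definition dot (R : realType) (m : nat) (u v : 'rV[R]_m) : R :=
  \sum_(i < m) u 0 i * v 0 i.

(* The unit sphere S^n in R^(n+1). Its tangent space at x is the orthogonal
   complement of x, and the round metric (constant curvature 1) is the
   restriction of [dot] to the tangent spaces. *)
Definition sphere (R : realType) (n : nat) : Type :=
  {x : 'rV[R]_n.+1 | dot x x == 1}.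

(* C^k on an open set: Frechet differentiable at every point of U, with all
   directional derivatives of class C^(k-1). *)
Fixpoint class_C (R : realType) (V W : normedModType R) (k : nat) (U : set V)
    (F : V -> W) {struct k} : Prop :=
  match k with
  | 0 => forall x, U x -> {for x, continuous F}
  | k'.+1 => (forall x, U x -> differentiable F x) /\
             (forall v : V, class_C k' U (fun x => 'D_v F x))
  end.

Definition smooth (R : realType) (V W : normedModType R) (U : set V)
    (F : V -> W) : Prop :=
  forall k, class_C k U F.

(* Open subsets of S^n are represented by open subsets U of R^(n+1), standing
   for their trace on S^n. Maps are total, but are only meaningful on U. As
   usual for a submanifold, a map is smooth if it extends locally to a smooth
   map of the ambient space. *)
Definition smooth_on (R : realType) (n : nat) (W : normedModType R)
    (U : set 'rV[R]_n.+1) (f : sphere R n -> W) : Prop :=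
  forall x : sphere R n, U (val x) ->
    exists V : set 'rV[R]_n.+1, exists F : 'rV[R]_n.+1 -> W,
      [/\ open V, V (val x), smooth V F &
          forall y : sphere R n, V (val y) -> f y = F (val y)].

Definition vmap (R : realType) (n : nat) : Type :=
  sphere R n -> 'rV[R]_n.+1.

Definition vector_field (R : realType) (n : nat) (U : set 'rV[R]_n.+1)
    (X : vmap R n) : Prop :=
  (forall x, U (val x) -> dot (val x) (X x) = 0) /\ smooth_on U X.

(* The derivative of f along X. At x, it is the derivative at t = 0 of f along
   the curve t |-> (x + t v) / |x + t v| in S^n, which has velocity v = X x. *)
Definition deriv_along (R : realType) (n : nat) (X : vmap R n)
    (f : sphere R n -> R) (x : sphere R n) : R :=
  'D_(X x) (fun y : 'rV[R]_n.+1 =>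
              f (insubd x ((Num.sqrt (dot y y))^-1 *: y))) (val x).

(* The Levi-Civita connection of the round metric, as an operator on local
   vector fields: on every open set it is an affine connection which is
   compatible with the metric and torsion-free. In the last clause the Lie
   bracket is spelled out as a derivation: [X, Y] f = X (Y f) - Y (X f). *)
Record levi_civita (R : realType) (n : nat)
    (nabla : vmap R n -> vmap R n -> vmap R n) : Prop := LeviCivita {
  lc_field : forall U X Y, open U -> vector_field U X -> vector_field U Y ->
    vector_field U (nabla X Y);
  lc_linearl : forall U (f : sphere R n -> R) X Y Z,
    open U -> smooth_on U (f : _ -> R^o) ->
    vector_field U X -> vector_field U Y -> vector_field U Z ->
    forall x, U (val x) ->
      nabla (fun y => f y *: X y + Y y) Z x = f x *: nabla X Z x + nabla Y Z x;
  lc_additive : forall U X Y Z, open U ->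
    vector_field U X -> vector_field U Y -> vector_field U Z ->
    forall x, U (val x) ->
      nabla X (fun y => Y y + Z y) x = nabla X Y x + nabla X Z x;
  lc_leibniz : forall U (f : sphere R n -> R) X Y,
    open U -> smooth_on U (f : _ -> R^o) ->
    vector_field U X -> vector_field U Y ->
    forall x, U (val x) ->
      nabla X (fun y => f y *: Y y) x =
      deriv_along X f x *: Y x + f x *: nabla X Y x;
  lc_metric : forall U X Y Z, open U ->
    vector_field U X -> vector_field U Y -> vector_field U Z ->
    forall x, U (val x) ->
      deriv_along X (fun y => dot (Y y) (Z y)) x =
      dot (nabla X Y x) (Z x) + dot (Y x) (nabla X Z x);
  lc_torsion_free : forall U X Y (f : sphere R n -> R), open U ->
    vector_field U X -> vector_field U Y -> smooth_on U (f : _ -> R^o) ->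
    forall x, U (val x) ->
      deriv_along (fun y => nabla X Y y - nabla Y X y) f x =
      deriv_along X (deriv_along Y f) x - deriv_along Y (deriv_along X f) x
}.

(* TS^n-valued p-forms, as maps on p-tuples of (local) vector fields. *)
Definition form (R : realType) (n p : nat) : Type :=
  ('I_p -> vmap R n) -> vmap R n.

Definition nabla_form (R : realType) (n p : nat)
    (nabla : vmap R n -> vmap R n -> vmap R n) (X : vmap R n)
    (w : form R n p) : form R n p :=
  fun Xs x => nabla X (w Xs) x -
    \sum_(j < p) w (fun i => if i == j then nabla X (Xs i) else Xs i) x.

Definition d_form (R : realType) (n p : nat)
    (nabla : vmap R n -> vmap R n -> vmap R n)
    (w : form R n p) : form R n p.+1 :=
  fun Xs x => \sum_(k < p.+1)
    (-1) ^+ k *: nabla_form nabla (Xs k) w (fun i => Xs (lift k i)) x.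

Definition local_orthonormal_frame (R : realType) (n : nat) (x : sphere R n)
    (e : 'I_n -> vmap R n) : Prop :=
  exists U : set 'rV[R]_n.+1,
    [/\ open U, U (val x), forall i, vector_field U (e i) &
        forall y : sphere R n, U (val y) ->
          forall i j, dot (e i y) (e j y) = (i == j)%:R].

(* A choice of orthonormal frame near each point; on forms, the codifferential
   does not depend on it. *)
Definition frame (R : realType) (n : nat) (x : sphere R n) :
    'I_n -> vmap R n :=
  xget (fun _ _ => 0) [set e | local_orthonormal_frame x e].

Definition cons_field (R : realType) (n p : nat) (X : vmap R n)
    (Xs : 'I_p -> vmap R n) : 'I_p.+1 -> vmap R n :=
  fun i => if unlift ord0 i is Some j then Xs j else X.

Definition codiff (R : realType) (n p : nat)
    (nabla : vmap R n -> vmap R n -> vmap R n)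
    (w : form R n p.+1) : form R n p :=
  fun Xs x => - \sum_(i < n)
    nabla_form nabla (frame x i) w (cons_field (frame x i) Xs) x.

(* The codifferential vanishes on 0-forms. *)
Definition hodge_laplacian (R : realType) (n p : nat)
    (nabla : vmap R n -> vmap R n -> vmap R n) :
    form R n p -> form R n p :=
  match p return form R n p -> form R n p with
  | 0 => fun w => codiff nabla (d_form nabla w)
  | q.+1 => fun w Xs x => d_form nabla (codiff nabla w) Xs x +
                          codiff nabla (d_form nabla w) Xs x
  end.

(* A field of endomorphisms of TS^n is given by matrices acting on row vectors;
   only the restriction of J x to the tangent space at x is relevant. *)
Definition almost_complex_structure (R : realType) (n : nat)
    (J : sphere R n -> 'M[R]_n.+1) : Prop :=
  smooth_on setT J /\
  forall (x : sphere R n) (v : 'rV[R]_n.+1), dot (val x) v = 0 ->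
    dot (val x) (v *m J x) = 0 /\ v *m J x *m J x = - v.

Definition endo_form (R : realType) (n : nat)
    (J : sphere R n -> 'M[R]_n.+1) : form R n 1 :=
  fun Xs x => Xs ord0 x *m J x.

Definition harmonic_complex_structure (R : realType) (n : nat)
    (nabla : vmap R n -> vmap R n -> vmap R n)
    (J : sphere R n -> 'M[R]_n.+1) : Prop :=
  almost_complex_structure J /\
  forall Xs : 'I_1 -> vmap R n, (forall i, vector_field setT (Xs i)) ->
    forall x, hodge_laplacian nabla (endo_form J) Xs x = 0.

(* Main.v *)
Require Import Defs.
From mathcomp Require Import all_boot all_order all_algebra.
From mathcomp Require Import all_classical all_reals all_analysis.
From mathcomp Require Import ring lra.
From mathcomp Require Import complex.
Set Implicit Arguments.
Unset Strict Implicit.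
Unset Printing Implicit Defensive.
Import Order.TTheory GRing.Theory Num.Theory.
Import numFieldNormedType.Exports.
Local Open Scope classical_set_scope.
Local Open Scope ring_scope.

(** The proof is a Weitzenboeck formula followed by the maximum principle.

    On the unit sphere of dimension n, commuting second covariant derivatives
    with the curvature R(u,v)w = <v,w>u - <u,w>v turns the Hodge Laplacian of
    an endomorphism field J into
      Laplacian J = - tr(nabla^2 J) + (n - 1) J + J^T - tr(J) Id.
    A complex structure on a real vector space has trace zero. So, if J is
    harmonic, then tr(nabla^2 J) = (n - 1) J + J^T, and half the trace of the
    Hessian of the function |J|^2 is
      |nabla J|^2 + (n - 1) |J|^2 + <J^T, J>
    which is at least (n - 2) |J|^2 because |<J^T, J>| <= |J|^2. For n > 2 this is
    positive everywhere. But the sphere is compact, so |J|^2 has a maximum, and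
    there the Hessian has no positive trace.

    Everything is computed in the ambient space R^(n+1), with row vectors. Let
    P(x) be the orthogonal projection onto the tangent space at x
    ([tproj]) and B a local smooth extension of P J P ([tpart]). Then:
    - the axioms of the connection determine it: nabla_X Y is the tangential
      part of the ambient derivative of Y along X ([levi_civitaE]);
    - (nabla_X J) Y is Y (D_X B) P ([covJE]), and the second covariant derivative
      of J has an explicit expression in the first and second derivatives of
      B ([cov2E]);
    - the two halves d delta and delta d of the Laplacian are traces of second
      covariant derivatives ([hodge_laplacian_endo]), and adding them up gives
      the formula above with ambient derivatives ([weitzenboeck_formula]). There
      tr(nabla^2 J) is the sum of the D_e D_e B over an orthonormal basis e of the
      tangent space, minus n D_x B, compressed by P, plus 2 B;
    - at a maximum x of |B|^2 on the sphere, the second derivative along the great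
      circle with velocity e gives D_e D_e |B|^2 - D_x |B|^2 <= 0
      ([sphere_second_derivative_le0]).
    Bounding the sum of the |D_e B|^2 below by 0 discards its normal part, which
    is 2 |B|^2. This lowers the constant n - 2 above to n - 4, so the argument is
    carried out for n > 4. *)

(** * Differential calculus of smooth maps *)

Section Calculus.
Variables (R : realType) (V : normedModType R).
Implicit Types (U : set V).

Lemma near_eq_differentiable (W : normedModType R) (f g : V -> W) x :
  (\near x, f x = g x) -> differentiable f x -> differentiable g x.
Proof.
move=> fg df; have [cdf /eqaddoP fE] := (diff_locallyP _ _).1 df.
have gE : g \o shift x = cst (g x) + 'd f x +o_ 0 id.
  apply/eqaddoP => e e0.
  have fgx := nbhs_singleton fg.
  have fg0 : \forall y \near (0 : V), f (y + x) = g (y + x).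
    by move: fg; rewrite (near_shift 0) /= subr0.
  apply: filter_app (fE e e0); apply: filterS fg0 => y /=.
  by rewrite /= !fctE /= fgx => ->.
have dg := diff_unique cdf gE.
by apply/diff_locallyP; rewrite dg; split.
Qed.

(** On an open set the derivatives of two equal functions are equal, so that
    [class_C] can be checked on any formula for the function. The Leibniz and
    quotient rules hold only on the open set, so their inductions need this. *)
Lemma class_C_eq (W : normedModType R) k U (f g : V -> W) : open U ->
  (forall x, U x -> f x = g x) -> class_C k U f -> class_C k U g.
Proof.
move=> oU; have fgn (f' g' : V -> W) x : (forall x, U x -> f' x = g' x) ->
    U x -> \near x, f' x = g' x.
  by move=> fg Ux; apply: filterS (open_nbhs_nbhs (conj oU Ux)).
elim: k f g => [|k IH] f g fg.
  move=> cf x Ux; suff: f @ x --> f x -> g @ x --> g x by apply; exact: cf.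
  by rewrite (fg x Ux); apply: cvg_trans; apply: near_eq_cvg; apply: fgn.
move=> [df cf]; split=> [x Ux|v].
  exact: near_eq_differentiable (fgn _ _ x fg Ux) (df x Ux).
by apply: IH (cf v) => x Ux; apply: near_eq_derive; exact: fgn.
Qed.

Lemma class_C_sub (W : normedModType R) k (U U' : set V) (f : V -> W) :
  U' `<=` U -> class_C k U f -> class_C k U' f.
Proof.
move=> sU; elim: k f => [|k IH] f; first by move=> cf x /sU; exact: cf.
by move=> [df cf]; split=> [x /sU|v]; [exact: df|exact: IH (cf v)].
Qed.

Lemma class_CW (W : normedModType R) k U (f : V -> W) :
  class_C k.+1 U f -> class_C k U f.
Proof.
elim: k f => [|k IH] f [df cf]; last by split=> // v; exact: IH (cf v).
by move=> x /df; exact: differentiable_continuous.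
Qed.

Lemma class_C_cst (W : normedModType R) k U (c : W) :
  class_C k U (fun=> c).
Proof.
elim: k c => [|k IH] c; first by move=> x _; exact: cvg_cst.
split=> [x _|v]; first exact: differentiable_cst.
rewrite (_ : 'D_v _ = fun=> 0); first exact: IH.
by rewrite funeqE => x; exact: derive_cst.
Qed.

Lemma class_CD (W : normedModType R) k U (f g : V -> W) : open U ->
  class_C k U f -> class_C k U g -> class_C k U (fun x => f x + g x).
Proof.
move=> oU; elim: k f g => [|k IH] f g.
  by move=> cf cg x Ux; apply: cvgD; [exact: cf|exact: cg].
move=> [df cf] [dg cg]; split=> [x Ux|v].
  by apply: differentiableD; [exact: df|exact: dg].
apply: (class_C_eq oU) (IH _ _ (cf v) (cg v)) => x Ux.
by rewrite -deriveD //; apply/diff_derivable; [exact: df|exact: dg].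
Qed.

Lemma class_C_sum (W : normedModType R) k U (I : Type) (r : seq I)
    (f : I -> V -> W) : open U ->
  (forall i, class_C k U (f i)) -> class_C k U (fun x => \sum_(i <- r) f i x).
Proof.
move=> oU cf; elim: r => [|i r IH].
  by rewrite (_ : (fun=> _) = fun=> 0) ?funeqE => [|x]; rewrite ?big_nil//;
    exact: class_C_cst.
rewrite (_ : (fun=> _) = fun x => f i x + \sum_(j <- r) f j x); last first.
  by rewrite funeqE => x; rewrite big_cons.
exact: class_CD.
Qed.

Lemma class_CM k U (f g : V -> R^o) : open U ->
  class_C k U f -> class_C k U g -> class_C k U (fun x => f x * g x : R^o).
Proof.
move=> oU; elim: k f g => [|k IH] f g.
  by move=> cf cg x Ux; apply: cvgM; [exact: cf|exact: cg].
move=> Cf Cg; have [df cf] := Cf; have [dg cg] := Cg; split=> [x Ux|v].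
  by apply: differentiableM; [exact: df|exact: dg].
have := class_CD oU (IH _ _ (class_CW Cf) (cg v)) (IH _ _ (class_CW Cg) (cf v)).
apply: (class_C_eq oU) => x Ux.
by rewrite -[LHS]deriveM //; apply/diff_derivable; [exact: df|exact: dg].
Qed.

Lemma class_CV k U (f : V -> R^o) : open U -> (forall x, U x -> f x != 0) ->
  class_C k U f -> class_C k U (fun x => (f x)^-1 : R^o).
Proof.
move=> oU f0; elim: k => [|k IH] Cf.
  by move=> x Ux; apply: cvgV; [exact: f0|exact: Cf].
have [df cf] := Cf; split=> [x Ux|v].
  by apply: differentiableV; [exact: df|exact: f0].
have Ci := IH (class_CW Cf).
have := class_CM oU (class_CM oU (@class_C_cst _ k U (-1 :
  R^o)) (class_CM oU Ci Ci)) (cf v).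
apply: (class_C_eq oU) => x Ux.
rewrite [RHS]deriveV ?f0//; last by apply/diff_derivable/df.
by rewrite -exprVn mulN1r expr2.
Qed.

Lemma derive_entry m n (F : V -> 'M[R]_(m, n)) x v i j :
  derivable F x v -> 'D_v (fun y => F y i j : R^o) x = ('D_v F x) i j.
Proof. by move=> dF; rewrite derive_mx// mxE. Qed.

Lemma differentiable_entry m n (F : V -> 'M[R]_(m, n)) x i j :
  differentiable F x -> differentiable (fun y => F y i j : R^o) x.
Proof. by move=> dF; apply: differentiable_comp dF (differentiable_coord _ _
  _). Qed.

Lemma class_CZl (W : normedModType R) k U (f : V -> R^o) (w : W) : open U ->
  class_C k U f -> class_C k U (fun x => f x *: w).
Proof.
move=> oU; elim: k f => [|k IH] f.
  by move=> cf x Ux; apply: cvgZr_tmp; exact: cf.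
move=> [df cf]; split=> [x Ux|v].
  by apply: differentiableZl; exact: df.
apply: (class_C_eq oU) (IH _ (cf v)) => x Ux.
rewrite !deriveE ?diffZl//; first exact: df; last exact: df.
by apply: differentiableZl; exact: df.
Qed.

(** Since a matrix is a finite sum of entries times constant matrices, all
    questions about matrix-valued maps reduce to real-valued ones. *)
Lemma class_C_mxP m n k U (F : V -> 'M[R]_(m, n)) : open U ->
  class_C k U F <-> forall i j, class_C k U (fun x => F x i j : R^o).
Proof.
move=> oU; split; last first.
  move=> cF; rewrite (_ : F = fun x => \sum_(i <- enum 'I_m)
    \sum_(j <- enum 'I_n) F x i j *: delta_mx i j).
    by do 2 (apply: class_C_sum => // ?); exact: class_CZl.
  rewrite funeqE => x; rewrite [LHS]matrix_sum_delta !big_enum.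
  by apply: eq_bigr => i _; rewrite big_enum.
elim: k F => [|k IH] F.
  move=> cF i j x Ux.
  exact: (continuous_comp (cF x Ux)) (@coord_continuous _ _ _ i j _).
move=> [dF cF] i j.
split=> [x Ux|v].
  exact/differentiable_entry/dF.
have /IH/(_ i j) := cF v; apply: (class_C_eq oU) => x Ux.
by rewrite derive_entry//; exact/diff_derivable/dF.
Qed.

Lemma class_C_mulmx m n p k U (F : V -> 'M[R]_(m, n)) (G : V -> 'M[R]_(n, p)) :
  open U -> class_C k U F -> class_C k U G -> class_C k U (fun x => F x *m G x).
Proof.
move=> oU /class_C_mxP-/(_ oU) cF /class_C_mxP-/(_ oU) cG.
apply/class_C_mxP => // i j.
rewrite (_ : (fun=> _) = fun x => \sum_(l <- enum 'I_n) F x i l * G x l j).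
  by apply: class_C_sum => // l; exact: class_CM.
by rewrite funeqE => x; rewrite mxE big_enum.
Qed.

Lemma is_derive_mulmx m n p
    (F : V -> 'M[R]_(m, n)) (G : V -> 'M[R]_(n, p)) x v :
  derivable F x v -> derivable G x v ->
  is_derive x v (fun y => F y *m G y) ('D_v F x *m G x + F x *m 'D_v G x).
Proof.
move=> dF dG.
have D i j : is_derive x v (fun y => (F y *m G y) i j : R^o)
    (('D_v F x *m G x + F x *m 'D_v G x) i j).
  have -> : (fun y => (F y *m G y) i j : R^o) =
      \sum_(l < n) ((fun y => F y i l : R^o) * (fun y => G y l j : R^o)).
    by rewrite funeqE => y; rewrite mxE fct_sumE.
  have dFl l : is_derive x v (fun y => F y i l : R^o) ('D_v F x i l).
    by apply: DeriveDef; [exact: (derivable_mxP _ _ _).1|exact: derive_entry].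
  have dGl l : is_derive x v (fun y => G y l j : R^o) ('D_v G x l j).
    by apply: DeriveDef; [exact: (derivable_mxP _ _ _).1|exact: derive_entry].
  apply: is_derive_eq; rewrite !mxE -big_split/=; apply: eq_bigr => l _.
  by rewrite addrC; congr (_ + _); rewrite /GRing.scale/= mulrC.
have dFG : derivable (fun y => F y *m G y) x v.
  by apply/derivable_mxP => i j; exact: ex_derive.
by apply: DeriveDef => //; apply/matrixP => i j;
  rewrite -derive_entry ?derive_val.
Qed.

Lemma derive_mulmx m n p (F : V -> 'M[R]_(m, n)) (G : V -> 'M[R]_(n, p)) x v :
  derivable F x v -> derivable G x v ->
  'D_v (fun y => F y *m G y) x = 'D_v F x *m G x + F x *m 'D_v G x.
Proof. by move=> dF dG; exact: (@derive_val _ _ _ _ _ _ _ (is_derive_mulmx dF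
  dG)). Qed.

End Calculus.

Lemma class_C_id (R : realType) (V : normedModType R) k (U : set V) :
  class_C k U (id : V -> V).
Proof.
case: k => [|k]; first by move=> x _; exact: cvg_id.
split=> [x _|v]; first exact/(@ex_diff _ _ _ _ _ _ _ (is_diff_id _)).
rewrite (_ : 'D_v _ = fun=> v); first exact: class_C_cst.
by rewrite funeqE => x; exact: derive_id.
Qed.

Lemma class_C_trmx (R : realType) (V : normedModType R) m n k (U : set V)
  (F : V -> 'M[R]_(m, n)) : open U -> class_C k U F ->
    class_C k U (fun y => (F y)^T).
Proof.
move=> oU /(class_C_mxP _ _ oU) cF; apply/class_C_mxP => // i j.
by rewrite (_ : (fun=> _) = fun y => F y j i) ?funeqE// => y; rewrite mxE.
Qed.

Lemma class_CZ (R : realType) (V : normedModType R) m n k (U : set V)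
  (f : V -> R^o) (F : V -> 'M[R]_(m, n)) : open U ->
  class_C k U f -> class_C k U F -> class_C k U (fun y => (f y : R) *: F y).
Proof.
move=> oU cf /(class_C_mxP _ _ oU) cF; apply/class_C_mxP => // i j.
rewrite (_ : (fun=> _) = fun y => f y * F y i j : R^o); first exact: class_CM.
by rewrite funeqE => y; rewrite mxE.
Qed.

Lemma is_derive_trmx (R : realType) (V : normedModType R) m n
    (F : V -> 'M[R]_(m, n)) x v :
  derivable F x v -> is_derive x v (fun y => (F y)^T) ('D_v F x)^T.
Proof.
move=> dF; have dFT : derivable (fun y => (F y)^T) x v.
  apply/derivable_mxP => i j; rewrite (_ : (fun=> _) = fun y => F y j i).
    exact: (derivable_mxP _ _ _).1.
  by rewrite funeqE => y; rewrite mxE.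
apply: DeriveDef => //; apply/matrixP => i j; rewrite -derive_entry// mxE.
rewrite -derive_entry//; congr ('D_v _ x).
by rewrite funeqE => y; rewrite mxE.
Qed.

(** The curve h |-> N (x + h v) has one real variable, where derivable and
    differentiable coincide. Hence a directional derivative of N is enough. *)
Lemma is_derive_comp (R : realType) (V W Z : normedModType R)
    (F : W -> Z) (N : V -> W) x v : derivable N x v -> differentiable F (N x) ->
  is_derive x v (F \o N) ('D_('D_v N x) F (N x)).
Proof.
move=> /derivable1P dN dF.
have dN1 : differentiable (fun h : R => N (h *: v + x)) 0
  by apply/derivable1_diffP.
have N0 : N (0 *: v + x) = N x by rewrite scale0r add0r.
have dF0 : differentiable F ((fun h : R => N (h *: v + x)) 0) by rewrite /= N0.
have dFN := differentiable_comp dN1 dF0.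
have E (Y : normedModType R) (G : V -> Y) :
    'D_v G x = 'D_1 (fun h : R => G (h *: v + x)) 0.
  rewrite /derive; set g1 := fun h => _; set g2 := fun h => _.
  suff -> : g1 = g2 by []; rewrite funeqE => h; rewrite /g1 /g2 /=.
  by rewrite addr0 scale0r add0r [_%:A]mulr1.
apply: DeriveDef; first by apply/derivable1P/derivable1_diffP.
rewrite E -[LHS]/('D_1 (F \o (fun h : R => N (h *: v + x))) 0).
rewrite (deriveE _ dFN) (diff_comp dN1 dF0) /= -(deriveE _ dN1) -E.
by rewrite -(deriveE _ dF0) N0.
Qed.

Section DirectionField.
Variables (R : realType) (m : nat).
Implicit Types (V : set 'rV[R]_m).

Lemma derive_dirD (W : normedModType R) (f : 'rV[R]_m -> W) a u v :
  differentiable f a -> 'D_(u + v) f a = 'D_u f a + 'D_v f a.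
Proof. by move=> df; rewrite !deriveE// linearD. Qed.

Lemma derive_dirZ (W : normedModType R) (f : 'rV[R]_m -> W) a c u :
  differentiable f a -> 'D_(c *: u) f a = c *: 'D_u f a.
Proof. by move=> df; rewrite !deriveE// linearZ. Qed.

Lemma derive_dirBZ (W : normedModType R) (f : 'rV[R]_m -> W) a c u v :
  differentiable f a -> 'D_(u - c *: v) f a = 'D_u f a - c *: 'D_v f a.
Proof. by move=> df; rewrite !deriveE// linearB linearZ. Qed.

Lemma derive_dir_sum (W : normedModType R) (f : 'rV[R]_m -> W) a I (r : seq I)
    (u : I -> 'rV[R]_m) :
  differentiable f a -> 'D_(\sum_(i <- r) u i) f a = \sum_(i <- r) 'D_(u i) f a.
Proof.
by move=> df; rewrite !deriveE// linear_sum; apply: eq_bigr => i _;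
  rewrite deriveE.
Qed.

Lemma derive_dir_delta (W : normedModType R) (f : 'rV[R]_m -> W) a u :
  differentiable f a -> 'D_u f a = \sum_b u 0 b *: 'D_(delta_mx 0 b) f a.
Proof.
move=> df; rewrite {1}(row_sum_delta u) derive_dir_sum//.
by apply: eq_bigr => b _; rewrite derive_dirZ.
Qed.

Lemma class_C_derive_field k V
    (X : 'rV[R]_m -> 'rV[R]_m) (f : 'rV[R]_m -> R^o) :
  open V -> smooth V X -> smooth V f -> class_C k V (fun y => 'D_(X y) f y).
Proof.
move=> oV sX sf.
have : class_C k V (fun y => \sum_(b <- enum 'I_m) X y 0 b * 'D_(delta_mx 0 b)
  f y : R^o).
  apply: class_C_sum => // b; apply: class_CM => //; last exact: (sf k.+1).2.
  exact: ((class_C_mxP _ _ oV).1 (sX k)).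
apply: class_C_eq => // y Vy; rewrite derive_dir_delta; last exact: (sf 1).1.
by rewrite big_enum.
Qed.

Lemma class_C_derive_field_mx k V p q (X : 'rV[R]_m -> 'rV[R]_m)
    (F : 'rV[R]_m -> 'M[R]_(p, q)) :
  open V -> smooth V X -> smooth V F -> class_C k V (fun y => 'D_(X y) F y).
Proof.
move=> oV sX sF; apply/class_C_mxP => // i j.
have sFij : smooth V (fun y => F y i j : R^o).
  by move=> l; exact: ((class_C_mxP _ _ oV).1 (sF l)).
apply: class_C_eq (class_C_derive_field k oV sX sFij) => // y Vy.
by rewrite derive_entry//; exact/diff_derivable/(sF 1).1.
Qed.

(** The Leibniz rule, for the sum of the X_b times the partial derivatives of f. *)
Lemma derive_derive_field V
    (X : 'rV[R]_m -> 'rV[R]_m) (f : 'rV[R]_m -> R^o) w a :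
  open V -> V a -> smooth V X -> smooth V f ->
  'D_w (fun y => 'D_(X y) f y) a =
  'D_('D_w X a) f a + 'D_w (fun y => 'D_(X a) f y) a.
Proof.
move=> oV Va sX sf.
have nV : \forall y \near a, V y by apply: open_nbhs_nbhs.
have dX : derivable X a w by exact/diff_derivable/(sX 1).1.
have df : differentiable f a by exact: (sf 1).1.
have E (Y : 'rV[R]_m -> 'rV[R]_m) : \forall y \near a,
    (\sum_(b < m) ((fun y => Y y 0 b : R^o) * ('D_(delta_mx 0 b) f))) y =
      'D_(Y y) f y.
  apply: filterS nV => y Vy; rewrite derive_dir_delta ?fct_sumE//.
  exact: (sf 1).1.
have dD b : derivable ('D_(delta_mx 0 b) f) a w.
  by apply/diff_derivable; exact: ((sf 2).2 _).1.
have dXb b : is_derive a w (fun y => X y 0 b : R^o) ('D_w X a 0 b).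
  by apply: DeriveDef; [exact: (derivable_mxP _ _ _).1|exact: derive_entry].
have dDb b := derivableP (dD b).
rewrite -(near_eq_derive w (E X)) -(near_eq_derive w (E (fun=> X a))).
rewrite derive_val derive_val (derive_dir_delta _ df) -big_split/=.
apply: eq_bigr => b _; rewrite scaler0 addr0 addrC; congr (_ + _).
by rewrite /GRing.scale/= mulrC.
Qed.

Lemma derive_derive_field_mx V p q (X : 'rV[R]_m -> 'rV[R]_m)
    (F : 'rV[R]_m -> 'M[R]_(p, q)) w a :
  open V -> V a -> smooth V X -> smooth V F ->
  'D_w (fun y => 'D_(X y) F y) a =
  'D_('D_w X a) F a + 'D_w (fun y => 'D_(X a) F y) a.
Proof.
move=> oV Va sX sF.
have sFij i j : smooth V (fun y => F y i j : R^o).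
  by move=> l; exact: ((class_C_mxP _ _ oV).1 (sF l)).
have nV : \forall y \near a, V y by apply: open_nbhs_nbhs.
have dF (y v : 'rV[R]_m) : V y -> derivable F y v.
  by move=> Vy; exact/diff_derivable/(sF 1).1.
have sc (u : 'rV[R]_m) : smooth V (fun=> u) by move=> k; exact: class_C_cst.
have entry Y : smooth V Y -> forall i j,
   'D_w (fun y => 'D_(Y y) F y) a i j = 'D_w (fun y => 'D_(Y y) (fun z =>
     F z i j : R^o) y) a.
  move=> sY i j; rewrite -derive_entry; last first.
    exact/diff_derivable/(class_C_derive_field_mx 1 oV sY sF).1.
  apply: near_eq_derive; apply: filterS nV => y Vy.
  by rewrite derive_entry//; exact: dF.
have addE (A B : 'M[R]_(p, q)) i j : (A + B) i j = A i j + B i j by rewrite mxE.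
apply/matrixP => i j; apply: (etrans (entry X sX i j)).
apply: (etrans (derive_derive_field w oV Va sX (sFij i j))).
apply: (etrans _ (esym (addE _ _ i j))).
exact: (congr2 +%R (derive_entry i j (dF _ _ Va)) (esym (entry _ (sc (X a))
  i j))).
Qed.

End DirectionField.

(** * Inner products *)

Lemma dotE (R : realType) m (u v : 'rV[R]_m) : dot u v = (u *m v^T) 0 0.
Proof. by rewrite /dot mxE; apply: eq_bigr => i _; rewrite mxE. Qed.

Lemma mul_row_trmx (R : realType) m (u v : 'rV[R]_m) : u *m v^T = (dot u v)%:M.
Proof. by rewrite [LHS]mx11_scalar -dotE. Qed.

Lemma dotC (R : realType) m (u v : 'rV[R]_m) : dot u v = dot v u.
Proof. by apply: eq_bigr => i _; rewrite mulrC. Qed.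

Lemma dotDl (R : realType) m (u v w : 'rV[R]_m) : dot (u + v) w =
  dot u w + dot v w.
Proof. by rewrite !dotE mulmxDl mxE. Qed.

Lemma dotNl (R : realType) m (u w : 'rV[R]_m) : dot (- u) w = - dot u w.
Proof. by rewrite !dotE mulNmx mxE. Qed.

Lemma dotBl (R : realType) m (u v w : 'rV[R]_m) : dot (u - v) w =
  dot u w - dot v w.
Proof. by rewrite dotDl dotNl. Qed.

Lemma dotZl (R : realType) m (a : R) (u w : 'rV[R]_m) : dot (a *: u) w =
  a * dot u w.
Proof. by rewrite !dotE -scalemxAl mxE. Qed.

Lemma dotDr (R : realType) m (u v w : 'rV[R]_m) : dot u (v + w) =
  dot u v + dot u w.
Proof. by rewrite dotC dotDl ![dot _ u]dotC. Qed.

Lemma dotZr (R : realType) m (a : R) (u w : 'rV[R]_m) : dot u (a *: w) =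
  a * dot u w.
Proof. by rewrite dotC dotZl dotC. Qed.

Lemma dot_mull (R : realType) m p (u : 'rV[R]_m) (w : 'rV[R]_p) A :
  dot (u *m A) w = dot u (w *m A^T).
Proof. by rewrite !dotE trmx_mul trmxK mulmxA. Qed.

Lemma dot_eq0 (R : realType) m (u : 'rV[R]_m) : dot u u = 0 -> u = 0.
Proof.
move=> /eqP; rewrite psumr_eq0 => [|i _]; last by rewrite -expr2 sqr_ge0.
move=> /allP u0; apply/rowP => i; rewrite mxE.
by have /implyP/(_ isT) := u0 i (mem_index_enum i);
  rewrite mulf_eq0 orbb => /eqP.
Qed.

Lemma dot_delta (R : realType) n (u : 'rV[R]_n) i : dot u (delta_mx 0 i) =
  u 0 i.
Proof.
rewrite /dot (bigD1 i)//= !mxE !eqxx mulr1 big1 ?addr0// => j /negPf ji.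
by rewrite !mxE ji andbF mulr0.
Qed.

Lemma class_C_dot (R : realType) (V : normedModType R) m k (U : set V)
  (F G : V -> 'rV[R]_m) : open U -> class_C k U F -> class_C k U G ->
  class_C k U (fun y => dot (F y) (G y) : R^o).
Proof.
move=> oU cF cG; rewrite (_ : (fun=> _) = fun y => (F y *m (G y)^T) 0 0 : R^o).
  by apply: (class_C_mxP _ _ oU).1; apply: class_C_mulmx => //;
    exact: class_C_trmx.
by rewrite funeqE => y; rewrite dotE.
Qed.

Lemma is_derive_dot (R : realType) (V : normedModType R) m
    (F G : V -> 'rV[R]_m) x v : derivable F x v -> derivable G x v ->
  is_derive x v (fun y => dot (F y) (G y) : R^o)
    (dot ('D_v F x) (G x) + dot (F x) ('D_v G x)).
Proof.
move=> dF dG; have dGT := is_derive_trmx dG.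
have dFG := @is_derive_mulmx _ _ _ _ _ F (fun y => (G y)^T)
  _ _ dF (@ex_derive _ _ _ _ _ _ _ dGT).
rewrite (_ : (fun=> _) = fun y => (F y *m (G y)^T) 0 0 : R^o); last first.
  by rewrite funeqE => y; rewrite dotE.
apply: DeriveDef; first by apply: (derivable_mxP _ _ _).1; exact: ex_derive.
by rewrite derive_entry ?derive_val// !dotE mxE.
Qed.

Lemma is_derive_mxtrace (R : realType) (V : normedModType R) m
    (F : V -> 'M[R]_m) x v :
  derivable F x v -> is_derive x v (fun y => \tr (F y) : R^o) (\tr ('D_v F x)).
Proof.
move=> dF; rewrite (_ : (fun=> _) = \sum_(i < m) (fun y => F y i i : R^o));
  last first.
  by rewrite funeqE => y; rewrite fct_sumE.
have D i : is_derive x v (fun y => F y i i : R^o) ('D_v F x i i).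
  by apply: DeriveDef; [exact: (derivable_mxP _ _ _).1|exact: derive_entry].
exact: is_derive_sum.
Qed.

Lemma is_derive_mxip (R : realType) (V : normedModType R) m p
    (F G : V -> 'M[R]_(m, p)) x v :
  derivable F x v -> derivable G x v ->
  is_derive x v (fun y => \tr (F y *m (G y)^T) : R^o)
    (\tr ('D_v F x *m (G x)^T) + \tr (F x *m ('D_v G x)^T)).
Proof.
move=> dF dG; have dT := is_derive_trmx dG.
have dFG := is_derive_mulmx dF (@ex_derive _ _ _ _ _ _ _ dT).
have D := is_derive_mxtrace (@ex_derive _ _ _ _ _ _ _ dFG).
apply: is_derive_eq D _.
by rewrite (@derive_val _ _ _ _ _ _ _ dFG) (@derive_val _ _ _ _ _ _ _ dT)
  mxtraceD.
Qed.

Lemma mxip_ge0 (R : realType) m p (A : 'M[R]_(m, p)) : 0 <= \tr (A *m A^T).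
Proof.
apply: sumr_ge0 => i _; rewrite mxE; apply: sumr_ge0 => j _.
by rewrite mxE -expr2 sqr_ge0.
Qed.

Lemma mxip_eq0 (R : realType) m p (A : 'M[R]_(m, p)) : \tr (A *m A^T) = 0 ->
  A = 0.
Proof.
have s0 i : 0 <= (A *m A^T) i i.
  by rewrite mxE; apply: sumr_ge0 => j _; rewrite mxE -expr2 sqr_ge0.
move=> /eqP; rewrite psumr_eq0 => [/allP H|i _]; last exact: s0.
apply/matrixP => i j; have /implyP/(_ isT) := H i (mem_index_enum i).
rewrite mxE psumr_eq0 => [/allP/(_ j (mem_index_enum j))/implyP/(_ isT)|k _].
  by rewrite !mxE mulf_eq0 orbb => /eqP.
by rewrite mxE -expr2 sqr_ge0.
Qed.

(** * Tangent vectors and vector fields on the sphere *)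

Lemma sphereP (R : realType) n (x : sphere R n) : dot (val x) (val x) = 1.
Proof. by apply/eqP; exact: (valP x). Qed.

(** The map y |-> y / |y| fixes the sphere, and its differential at a point of
    the sphere is the identity on tangent vectors. So composing with it does
    not change tangential derivatives of an extension. *)
Lemma deriv_along_ext (R : realType) n (X : vmap R n) (f : sphere R n -> R)
    (V : set 'rV[R]_n.+1) (F : 'rV[R]_n.+1 -> R^o) (x : sphere R n) :
  open V -> V (val x) ->
  (forall y, V (val y) -> f y = F (val y)) -> differentiable F (val x) ->
  dot (val x) (X x) = 0 -> deriv_along X f x = 'D_(X x) F (val x).
Proof.
move=> oV Vx fF dF xv; have x1 := sphereP x.
set v := X x in xv *.
have did : derivable (id : 'rV[R]_n.+1 -> _) (val x) v by exact: derivable_id.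
pose q (y : 'rV[R]_n.+1) : R^o := dot y y.
have dq : is_derive (val x) v q 0.
  apply: is_derive_eq (is_derive_dot did did) _.
  by rewrite derive_id xv addr0 /dot; under eq_bigr do rewrite mulrC; exact: xv.
have cq : {for val x, continuous q}.
  rewrite (_ : q = fun y => \sum_(i <- enum 'I_n.+1) y 0 i * y 0 i).
    have /(class_C_mxP _ _ openT) c := @class_C_id _ 'rV[R]_n.+1 0 setT.
    have := class_C_sum (enum 'I_n.+1) openT (fun i =>
      class_CM openT (c 0 i) (c 0 i)).
    by apply.
  by rewrite funeqE => y; rewrite big_enum.
pose s (t : R^o) : R^o := (Num.sqrt t)^-1.
have ds : differentiable s (q (val x)).
  rewrite (_ : q (val x) = 1)//; apply/derivable1_diffP/derivableV.
    by rewrite sqrtr1 oner_neq0.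
  by have ? := is_derive1_sqrt (ltr01 : 0 < 1 :> R); exact: ex_derive.
have cs := differentiable_continuous ds.
pose r := s \o q.
have r1 : r (val x) = 1 by rewrite /r /s /q /= x1 sqrtr1 invr1.
have dr : is_derive (val x) v r 0.
  have dsq := is_derive_comp (@ex_derive _ _ _ _ _ _ _ dq) ds.
  by apply: is_derive_eq dsq _; rewrite derive_val derive0.
have cr : {for val x, continuous r} by exact: continuous_comp cq cs.
(* The map N is the projection of R^(n+1) minus the origin to the sphere. *)
pose N (y : 'rV[R]_n.+1) : 'rV[R]_n.+1 := (r y : R) *: y.
have N1 : N (val x) = val x by rewrite /N r1 scale1r.
have cN : N @ val x --> val x.
  suff : N @ val x --> N (val x) by rewrite N1.
  have cr' : (r : _ -> R) @ val x --> (r (val x) : R) by exact: cr.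
  exact: (@cvgZ _ _ _ _ _ (r : _ -> R) (id : _ -> 'rV[R]_n.+1) _ _ cr' cvg_id).
have dN : is_derive (val x) v N v.
  have D j : is_derive (val x) v (fun y => N y 0 j : R^o) (v 0 j).
    have dj : is_derive (val x) v (fun y : 'rV[R]_n.+1 => y 0 j : R^o) (v 0 j).
      apply: DeriveDef; first exact: (derivable_mxP _ _ _).1.
      by rewrite derive_entry// derive_id.
    rewrite (_ : (fun=> _) = r * (fun y : 'rV[R]_n.+1 => y 0 j : R^o)).
      by apply: is_derive_eq; rewrite r1 scale1r scaler0 addr0.
    by rewrite funeqE => y; rewrite mxE.
  have dN' : derivable N (val x) v.
    by apply/derivable_mxP => i j; rewrite (ord1 i); exact: ex_derive.
  by apply: DeriveDef => //; apply/rowP => j;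
    rewrite -derive_entry// derive_val.
have dFN : is_derive (val x) v (F \o N) ('D_v F (val x)).
  have dF' : differentiable F (N (val x)) by rewrite N1.
  have dFN := is_derive_comp (@ex_derive _ _ _ _ _ _ _ dN) dF'.
  by apply: is_derive_eq dFN _; rewrite derive_val N1.
rewrite -[RHS](@derive_val _ _ _ _ _ _ _ dFN).
apply: near_eq_derive.
have VN : \forall y \near val x, V (N y).
  by apply: cN; apply: open_nbhs_nbhs.
have q0 : \forall y \near val x, 0 < q y.
  have cq' : (q : _ -> R) @ val x --> (1 : R) by rewrite -[X in _ --> X]x1;
    exact: cq.
  exact: (cvgr_gt 1 cq' 0 ltr01).
near=> y.
have qy : 0 < q y by near: y.
have Ny : dot (N y) (N y) == 1.
  rewrite /dot /N; under eq_bigr do rewrite !mxE mulrACA.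
  rewrite -mulr_sumr -/(dot y y) -/(q y)
    /r /s /= -expr2 exprVn sqr_sqrtr ?ltW//.
  by rewrite mulVf// gt_eqF.
have vN : val (insubd x (N y)) = N y by rewrite val_insubd Ny.
rewrite /= -[in RHS]vN -fF// vN.
by near: y.
Unshelve. all: by end_near. Qed.

(** By [deriv_along_ext], both sides are the derivative along the sphere of the
    common restriction of F and G. *)
Lemma derive_tangent (R : realType) n m p V (F G : 'rV[R]_n.+1 -> 'M[R]_(m, p))
    (x : sphere R n) w : open V -> V (val x) -> dot (val x) w = 0 ->
  (forall y : sphere R n, V (val y) -> F (val y) = G (val y)) ->
  differentiable F (val x) -> differentiable G (val x) ->
  'D_w F (val x) = 'D_w G (val x).
Proof.
move=> oV Vx tw FG dF dG; apply/matrixP => i j.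
have h (H : 'rV[R]_n.+1 -> 'M[R]_(m, p)) : differentiable H (val x) ->
    (forall y : sphere R n, V (val y) -> F (val y) = H (val y)) ->
    'D_w H (val x) i j = deriv_along (fun=> w) (fun y => F (val y) i j) x.
  move=> dH FH; rewrite -(derive_entry i j (@diff_derivable _ _ _ _ _ w dH)).
  apply/esym; apply: (deriv_along_ext oV Vx) => //;
    last exact: differentiable_entry.
  by move=> y Vy; rewrite FH.
exact: (etrans (h F dF (fun _ _ => erefl)) (esym (h G dG FG))).
Qed.

Section Tangent.
Variables (R : realType) (n : nat).
Implicit Types (x y : sphere R n) (u v w : 'rV[R]_n.+1) (U V : set 'rV[R]_n.+1).

Definition tproj (y : 'rV[R]_n.+1) : 'M[R]_n.+1 := 1%:M - y^T *m y.

Lemma tproj_sym (y : 'rV[R]_n.+1) : (tproj y)^T = tproj y.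
Proof. by rewrite /tproj linearB /= trmx1 trmx_mul trmxK. Qed.

Lemma mul_tproj v (y : 'rV[R]_n.+1) : v *m tproj y = v - dot v y *: y.
Proof. by rewrite mulmxBr mulmx1 mulmxA mul_row_trmx mul_scalar_mx. Qed.

Lemma tproj_tangent x v : dot (val x) v = 0 -> v *m tproj (val x) = v.
Proof. by rewrite mul_tproj dotC => ->; rewrite scale0r subr0. Qed.

Lemma tproj_normal x : val x *m tproj (val x) = 0.
Proof. by rewrite mul_tproj sphereP scale1r subrr. Qed.

Lemma tangent_tproj x v : dot (val x) (v *m tproj (val x)) = 0.
Proof. by rewrite dotC dot_mull tproj_sym tproj_normal dotE trmx0 mulmx0 mxE.
  Qed.

Lemma tproj_idem x : tproj (val x) *m tproj (val x) = tproj (val x).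
Proof.
apply/row_matrixP => i; rewrite !rowE mulmxA.
by apply: tproj_tangent; exact: tangent_tproj.
Qed.

Lemma class_C_tproj k U : open U -> class_C k U tproj.
Proof.
move=> oU; have oT := class_C_id k U.
have -> : tproj = fun y : 'rV[R]_n.+1 => 1%:M + ((-1)%:M *m y^T) *m y.
  by rewrite funeqE => y; rewrite /tproj mul_scalar_mx scaleN1r mulNmx.
apply: class_CD => //; first exact: class_C_cst.
apply: class_C_mulmx => //; apply: class_C_mulmx => //;
  first exact: class_C_cst.
exact: class_C_trmx.
Qed.

Lemma derive_tproj (a w : 'rV[R]_n.+1) :
  is_derive a w tproj (- (w^T *m a + a^T *m w)).
Proof.
have dT := is_derive_trmx (@derivable_id _ _ a w).
have dM := is_derive_mulmx (@ex_derive _ _ _ _ _ _ _ dT)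
  (@derivable_id _ _ a w).
rewrite (@derive_val _ _ _ _ _ _ _ dT) (derive_id a w) in dM.
have D := is_deriveB (is_derive_cst (1%:M : 'M[R]_n.+1) a w) dM.
by rewrite sub0r in D.
Qed.

(** These fields extend any given tangent vector to the whole sphere. For the
    standard basis they form an overcomplete global frame, which replaces
    the local orthonormal frames wherever smoothness in the base point matters. *)
Definition tfield (w : 'rV[R]_n.+1) : vmap R n := fun y => w *m tproj (val y).

Lemma smooth_tfield_ext (v : 'rV[R]_n.+1) :
  smooth setT (fun y : 'rV[R]_n.+1 => v *m tproj y).
Proof.
move=> k; apply: class_C_mulmx; [exact: openT|exact: class_C_cst|].
exact/class_C_tproj/openT.
Qed.

Lemma derive_tfield (v a u : 'rV[R]_n.+1) :
  'D_u (fun y : 'rV[R]_n.+1 => v *m tproj y) a = - (v *m (u^T *m a + a^T *m u)).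
Proof.
have dP := derive_tproj a u.
rewrite (derive_mulmx (derivable_cst v a u) (@ex_derive _ _ _ _ _ _ _ dP)).
by rewrite (@derive_val _ _ _ _ _ _ _ dP) derive_cst mul0mx add0r mulmxN.
Qed.

Lemma smooth_on_ext (W : normedModType R) U V
    (f : sphere R n -> W) (F : 'rV[R]_n.+1 -> W) :
  open V -> smooth V F -> (forall y, V (val y) -> f y = F (val y)) ->
  U `<=` V -> smooth_on U f.
Proof. by move=> oV sF fF UV x /UV Vx; exists V, F; split. Qed.

Lemma vector_field_tfield U w : vector_field U (tfield w).
Proof.
split=> [x _|]; first exact: tangent_tproj.
apply: (@smooth_on_ext _ U setT _ (fun y : 'rV[R]_n.+1 => w *m tproj y)) => //;
  first exact: openT.
move=> k; apply: class_C_mulmx; [exact: openT|exact: class_C_cst|].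
exact/class_C_tproj/openT.
Qed.

Lemma vector_field_sub U V X : V `<=` U -> vector_field U X -> vector_field V X.
Proof. by move=> VU [tX sX]; split=> [x /VU|x /VU]; [exact: tX|exact: sX]. Qed.

Lemma smooth_onP (W : normedModType R) U (f : sphere R n -> W) x : open U ->
  smooth_on U f -> U (val x) -> exists V (F : 'rV[R]_n.+1 -> W),
    [/\ open V, V (val x), smooth V F, V `<=` U &
        forall y, V (val y) -> f y = F (val y)].
Proof.
move=> oU sf Ux; have [V [F [oV Vx sF fF]]] := sf x Ux.
exists (V `&` U), F; split=> //; first exact: openI.
- by move=> k; apply: class_C_sub (sF k) => y [].
- by move=> y [/fF].
Qed.

Lemma smooth_differentiable (W : normedModType R) V (F : 'rV[R]_n.+1 -> W)
    (y : 'rV[R]_n.+1) : smooth V F -> V y -> differentiable F y.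
Proof. by move=> /(_ 1)[+ _]; apply. Qed.

Lemma vector_fieldB U X Y : open U -> vector_field U X -> vector_field U Y ->
  vector_field U (fun y => X y - Y y).
Proof.
move=> oU [tX sX] [tY sY]; split=> [x Ux|x Ux].
  by rewrite dotC dotBl ![dot _ (val x)]dotC tX ?tY ?subrr.
have [V [F [oV Vx sF VU fF]]] := smooth_onP oU sX Ux.
have [V' [G [oV' Vx' sG VU' fG]]] := smooth_onP oU sY Ux.
exists (V `&` V'), (fun y : 'rV[R]_n.+1 => F y + (-1)%:M *m G y); split.
- exact: openI.
- by [].
- move=> k; have oI : open (V `&` V') by exact: openI.
  apply: class_CD => //; first by apply: class_C_sub (sF k) => y [].
  apply: class_C_mulmx => //; first exact: class_C_cst.
  by apply: class_C_sub (sG k) => y [].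
- by move=> y [Vy Vy']; rewrite fF ?fG// mul_scalar_mx scaleN1r.
Qed.

Lemma vector_field_mul U X (J : sphere R n -> 'M[R]_n.+1) : open U ->
  vector_field U X -> smooth_on U J ->
  (forall x v, dot (val x) v = 0 -> dot (val x) (v *m J x) = 0) ->
  vector_field U (fun y => X y *m J y).
Proof.
move=> oU [tX sX] sJ tJ; split=> [x Ux|x Ux]; first exact/tJ/tX.
have [V [F [oV Vx sF VU fF]]] := smooth_onP oU sX Ux.
have [V' [G [oV' Vx' sG VU' fG]]] := smooth_onP oU sJ Ux.
exists (V `&` V'), (fun y : 'rV[R]_n.+1 => F y *m G y); split.
- exact: openI.
- by [].
- move=> k; have oI : open (V `&` V') by exact: openI.
  by apply: class_C_mulmx => //; [apply: class_C_sub (sF k) =>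
    y []|apply: class_C_sub (sG k) => y []].
- by move=> y [Vy Vy']; rewrite fF ?fG.
Qed.

End Tangent.

(** * The Levi-Civita connection of the round metric *)

Section LeviCivita.
Variables (R : realType) (n : nat) (nabla : vmap R n -> vmap R n -> vmap R n).
Hypothesis hnabla : levi_civita nabla.
Implicit Types (x : sphere R n) (U V : set 'rV[R]_n.+1) (X Y Z : vmap R n).

(** The flat connection of the ambient space, written with [deriv_along] so that it
    does not refer to an extension of Y. *)
Definition dfield X Y x : 'rV[R]_n.+1 :=
  \row_i deriv_along X (fun y => Y y 0 i) x.

Lemma dfieldE X Y V (Ye : 'rV[R]_n.+1 -> 'rV[R]_n.+1) x :
  open V -> V (val x) ->
  (forall y : sphere R n, V (val y) -> Y y = Ye (val y)) ->
  differentiable Ye (val x) ->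
  dot (val x) (X x) = 0 -> dfield X Y x = 'D_(X x) Ye (val x).
Proof.
move=> oV Vx YE dY xX; apply/rowP => i; rewrite mxE.
rewrite -derive_entry; last exact: diff_derivable.
rewrite (@deriv_along_ext _ _ X _ V (fun y => Ye y 0 i : R^o))//.
  by move=> y Vy; rewrite YE.
exact: differentiable_entry.
Qed.

(** The metric axiom of the connection minus the product rule for the ambient
    derivative. *)
Lemma dfield_metric U X Y Z x : open U -> U (val x) ->
  vector_field U X -> vector_field U Y -> vector_field U Z ->
  dot (nabla X Y x - dfield X Y x) (Z x) +
  dot (nabla X Z x - dfield X Z x) (Y x) = 0.
Proof.
move=> oU Ux vX vY vZ; have tX := vX.1 x Ux.
have [V [F [oV Vx sF VU fF]]] := smooth_onP oU vY.2 Ux.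
have [W [G [oW Wx sG WU fG]]] := smooth_onP oU vZ.2 Ux.
have dF := smooth_differentiable sF Vx; have dG := smooth_differentiable sG Wx.
have dF' := @diff_derivable _ _ _ _ _ (X x) dF.
have dG' := @diff_derivable _ _ _ _ _ (X x) dG.
have oVW : open (V `&` W) by exact: openI.
have := lc_metric hnabla oU vX vY vZ Ux.
rewrite (@deriv_along_ext _ _ X _ (V `&` W) (fun y => dot (F y) (G y) : R^o))//;
  first last.
- suff [+ _] : class_C 1 (V `&` W) (fun y => dot (F y) (G y) : R^o) by apply.
  apply: class_C_dot => //; first by apply: class_C_sub (sF 1) => y [].
  by apply: class_C_sub (sG 1) => y [].
- by move=> y [Vy Wy]; rewrite fF ?fG.
have dFG := is_derive_dot dF' dG'; rewrite derive_val => E.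
rewrite (dfieldE oV Vx fF dF tX) (dfieldE oW Wx fG dG tX).
move: E; rewrite -(fF x Vx) -(fG x Wx).
move: (nabla X Y x) (nabla X Z x) ('D_(X x) F _) ('D_(X x) G _) => a b c d E.
by rewrite !dotBl addrACA -opprD [dot b _]dotC -E [dot d _]dotC subrr.
Qed.

(** Applied to the coordinate functions, the axiom on the torsion says that the
    bracket is the commutator of ambient derivatives. *)
Lemma dfield_torsion U X Y x : open U -> U (val x) ->
  vector_field U X -> vector_field U Y ->
  nabla X Y x - nabla Y X x = dfield X Y x - dfield Y X x.
Proof.
move=> oU Ux vX vY; apply/rowP => i.
pose f (y : sphere R n) : R := val y 0 i.
pose F (y : 'rV[R]_n.+1) : R^o := y 0 i.
have fE Z y : dot (val y) (Z y) = 0 -> deriv_along Z f y = Z y 0 i.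
  move=> tZ; rewrite (@deriv_along_ext _ _ Z f setT F)//; last 2 first.
  - exact: openT.
  - exact: differentiable_coord.
  have := derive_entry 0 i (@derivable_id _ _ (val y) (Z y)).
  by rewrite derive_id.
have sf : smooth_on U (f : _ -> R^o).
  apply: (@smooth_on_ext _ _ _ U setT _ F) => //; first exact: openT.
  by move=> k; apply: ((class_C_mxP k id openT).1 (class_C_id _ _)).
have dfE Z Z' : vector_field U Z -> vector_field U Z' ->
    deriv_along Z (deriv_along Z' f) x = dfield Z Z' x 0 i.
  move=> vZ vZ'; have [V [G [oV Vx sG VU fG]]] := smooth_onP oU vZ'.2 Ux.
  have dG := smooth_differentiable sG Vx; have tZ := vZ.1 x Ux.
  have dGi := @differentiable_entry _ _ _ _ G (val x) 0 i dG.
  rewrite (dfieldE oV Vx fG dG tZ) -derive_entry; last exact: diff_derivable.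
  rewrite (@deriv_along_ext _ _ Z _ V (fun y => G y 0 i : R^o))//.
  by move=> y Vy; rewrite (fE Z' y (vZ'.1 y (VU _ Vy))) fG.
have := lc_torsion_free hnabla oU vX vY sf Ux.
rewrite !dfE// fE; last first.
  have vXY := lc_field hnabla oU vX vY; have vYX := lc_field hnabla oU vY vX.
  exact: (vector_fieldB oU vXY vYX).1.
by rewrite !mxE.
Qed.

(** Uniqueness of the Levi-Civita connection, in explicit form. The difference
    A(X,Y) of the connection and the ambient derivative is symmetric in X, Y by
    [dfield_torsion], and <A(X,Y),Z> is skew in Y, Z by [dfield_metric]. A trilinear
    form with these two symmetries vanishes, so A has no tangential part. *)
Lemma levi_civitaE U V X Y (Ye : 'rV[R]_n.+1 -> 'rV[R]_n.+1) x :
  open U -> U (val x) -> vector_field U X -> vector_field U Y ->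
  open V -> V (val x) ->
  (forall y : sphere R n, V (val y) -> Y y = Ye (val y)) ->
  differentiable Ye (val x) ->
  nabla X Y x = 'D_(X x) Ye (val x) *m tproj (val x).
Proof.
move=> oU Ux vX vY oV Vx YE dY; rewrite -(dfieldE oV Vx YE dY);
  last exact: vX.1.
have [A AE] : exists A : vmap R n -> vmap R n -> 'rV[R]_n.+1,
    forall X Y, A X Y = nabla X Y x - dfield X Y x.
  by exists (fun X Y => nabla X Y x - dfield X Y x).
have M X' Y' Z' : vector_field U X' -> vector_field U Y' -> vector_field U Z' ->
    dot (A X' Y') (Z' x) = - dot (A X' Z') (Y' x).
  by move=> vX' vY' vZ'; apply/eqP; rewrite -addr_eq0 !AE;
    exact/eqP/(@dfield_metric U).
have T X' Y' : vector_field U X' -> vector_field U Y' -> A X' Y' = A Y' X'.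
  move=> vX' vY'; have := dfield_torsion oU Ux vX' vY'.
  by rewrite !AE => /eqP; rewrite subr_eq => /eqP ->;
    rewrite addrAC [dfield _ _ x - _]addrC addrK addrC.
have A0 Z : vector_field U Z -> dot (A X Y) (Z x) = 0.
  move=> vZ; have : dot (A X Y) (Z x) = - dot (A X Y) (Z x).
    rewrite {1}(T X Y vX vY) (M Y X Z vY vX vZ) (T Y Z vY vZ)
      (M Z Y X vZ vY vX).
    by rewrite opprK (T Z X vZ vX) (M X Z Y vX vZ vY).
  by move/eqP; rewrite -addr_eq0 -mulr2n mulrn_eq0 => /eqP.
have AP : A X Y *m tproj (val x) = 0.
  apply: dot_eq0; rewrite dot_mull tproj_sym -mulmxA tproj_idem.
  exact: A0 (vector_field_tfield U (A X Y)).
move: AP; rewrite AE mulmxBl => /eqP; rewrite subr_eq0 => /eqP <-.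
by rewrite tproj_tangent//; apply: (lc_field hnabla oU vX vY).1.
Qed.

(** The normal part comes from differentiating <X, y> = 0: the second fundamental
    form of the sphere is minus the metric. *)
Lemma gauss_formula U X Z W (F : 'rV[R]_n.+1 -> 'rV[R]_n.+1) x :
  open U -> U (val x) -> vector_field U Z -> vector_field U X ->
  open W -> W (val x) -> W `<=` U -> smooth W F ->
  (forall y : sphere R n, W (val y) -> X y = F (val y)) ->
  'D_(Z x) F (val x) = nabla Z X x - dot (Z x) (X x) *: val x.
Proof.
move=> oU Ux vZ vX oW Wx WU sF fF; have dF := smooth_differentiable sF Wx.
have tw := vZ.1 x Ux.
have sG : smooth W (fun y : 'rV[R]_n.+1 => F y *m y^T).
  by move=> k; apply: class_C_mulmx => //; apply: class_C_trmx => //;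
    exact: class_C_id.
have G0 (y : sphere R n) : W (val y) -> F (val y) *m (val y)^T = 0.
  by move=> Wy; rewrite -fF// mul_row_trmx dotC (vX.1 y (WU _ Wy)) raddf0.
have D0 := derive_tangent oW Wx tw G0 (smooth_differentiable sG Wx)
  (differentiable_cst 0 _).
have dT := is_derive_trmx (@derivable_id _ _ (val x) (Z x)).
have E := derive_mulmx (@diff_derivable _ _ _ _ _ (Z x) dF)
  (@ex_derive _ _ _ _ _ _ _ dT).
have := etrans (esym E) (etrans D0 (derive_cst _ _ _)).
rewrite (@derive_val _ _ _ _ _ _ _ dT) (derive_id (val x) (Z x)).
rewrite (levi_civitaE oU Ux vZ vX oW Wx fF dF) mul_tproj -(fF x Wx)
  !mul_row_trmx.
move: ('D_(Z x) F _) => a /matrixP/(_ 0 0); rewrite !mxE eqxx !mulr1n => /eqP.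
by rewrite addr_eq0 => /eqP ->; rewrite [dot (X x) _]dotC scaleNr opprK addrK.
Qed.

Lemma nabla_tfield U X v x : open U -> U (val x) -> vector_field U X ->
  nabla X (tfield v) x = - dot v (val x) *: X x.
Proof.
move=> oU Ux vX; have D := smooth_differentiable (smooth_tfield_ext v) (I :
  setT (val x)).
rewrite (levi_civitaE oU Ux vX (vector_field_tfield U v) openT I (fun _ _ =>
  erefl) D).
rewrite derive_tfield mulNmx mulmxDr !mulmxA mulmxDl -(mulmxA _ (val x))
  tproj_normal mulmx0 add0r.
by rewrite -(mulmxA (v *m _)) (tproj_tangent (vX.1 x Ux))
  mul_row_trmx mul_scalar_mx scaleNr.
Qed.

Lemma nablaB U X Y Z x : open U -> U (val x) ->
  vector_field U X -> vector_field U Y -> vector_field U Z ->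
  nabla X (fun y => Y y - Z y) x = nabla X Y x - nabla X Z x.
Proof.
move=> oU Ux vX vY vZ; have vYZ := vector_fieldB oU vY vZ.
have := lc_additive hnabla oU vX vYZ vZ Ux.
rewrite (_ : (fun y => Y y - Z y + Z y) = Y); first by move=> ->; rewrite addrK.
by rewrite funeqE => y; rewrite subrK.
Qed.

Lemma nabla_sumN U X (I : Type) (r : seq I) (Y : I -> vmap R n) x : open U ->
  U (val x) ->
  vector_field U X -> (forall i, vector_field U (Y i)) ->
  vector_field U (fun y => - \sum_(i <- r) Y i y) /\
  nabla X (fun y => - \sum_(i <- r) Y i y) x = - \sum_(i <- r) nabla X (Y i) x.
Proof.
move=> oU Ux vX vY; elim: r => [|i r [vr IH]].
  rewrite (_ : (fun y => - _) = fun y => X y - X y); last first.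
    by rewrite funeqE => y; rewrite big_nil oppr0 subrr.
  rewrite (nablaB oU Ux vX vX vX) big_nil oppr0 subrr; split=> //.
  exact: vector_fieldB.
rewrite (_ : (fun y => - _) = fun y => (- \sum_(i <- r) Y i y) - Y i y);
  last first.
  by rewrite funeqE => y; rewrite big_cons opprD addrC.
rewrite (nablaB oU Ux vX vr (vY i)) IH big_cons opprD addrC; split=> //.
exact: vector_fieldB.
Qed.

(** Symmetry of second derivatives is contained in the torsion axiom. The
    fields u P(y) and v P(y) commute at x, since their derivatives are
    -<u,v> x for both, so the axiom gives D_u D_v F - D_v D_u F = 0 there. *)
Lemma derive_comm V m p (f : sphere R n -> 'M[R]_(m, p))
    (F : 'rV[R]_n.+1 -> 'M[R]_(m, p)) x u v : open V -> V (val x) ->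
  smooth V F -> (forall y : sphere R n, V (val y) -> f y = F (val y)) ->
  dot (val x) u = 0 -> dot (val x) v = 0 ->
  'D_u ('D_v F) (val x) = 'D_v ('D_u F) (val x).
Proof.
move=> oV Vx sF fF xu xv.
have sFij i j : smooth V (fun y => F y i j : R^o).
  by move=> k; exact: ((class_C_mxP _ _ oV).1 (sF k)).
have sT (w : 'rV[R]_n.+1) : smooth V (fun y : 'rV[R]_n.+1 => w *m tproj y).
  by move=> k; apply: class_C_sub (smooth_tfield_ext w k).
pose X (w : 'rV[R]_n.+1) : vmap R n := tfield w.
have vX w : vector_field V (X w) by exact: vector_field_tfield.
have tX w : dot (val x) w = 0 -> X w x = w by exact: tproj_tangent.
have entry w w' i j : 'D_w ('D_w' F) (val x) i j =
    'D_w ('D_w' (fun y => F y i j : R^o)) (val x).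
  rewrite -derive_entry; last exact/diff_derivable/((sF 2).2 w').1.
  apply: near_eq_derive; apply: filterS (open_nbhs_nbhs (conj oV Vx)) => y Vy.
  by rewrite derive_entry//; exact/diff_derivable/(sF 1).1.
apply/matrixP => i j; apply: (etrans (entry u v i j)).
apply: (etrans _ (esym (entry v u i j))).
pose g (y : sphere R n) : R := f y i j.
have gE y : V (val y) -> g y = F (val y) i j by move=> Vy; rewrite /g fF.
have sg : smooth_on V (g : _ -> R^o)
  by apply: (@smooth_on_ext _ _ _ V V _ (fun y => F y i j : R^o)).
have D1 w y : V (val y) -> deriv_along (X w) g y =
    'D_(w *m tproj (val y)) (fun y => F y i j : R^o) (val y).
  move=> Vy; apply: (deriv_along_ext oV Vy gE); last exact: (vX w).1.
  exact: ((sFij i j) 1).1.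
have D2 w w' : dot (val x) w = 0 -> dot (val x) w' = 0 ->
    deriv_along (X w) (deriv_along (X w') g) x =
    'D_(- dot w' w *: val x) (fun y => F y i j : R^o) (val x) +
    'D_w ('D_w' (fun y => F y i j : R^o)) (val x).
  move=> xw xw'; have H := class_C_derive_field 1 oV (sT w') (sFij i j).
  apply: (etrans (deriv_along_ext oV Vx (D1 w') (H.1 _ Vx) ((vX w).1 _ Vx))).
  rewrite (tX w xw).
  apply: (etrans (derive_derive_field w oV Vx (sT w') (sFij i j))).
  rewrite (tproj_tangent xw') derive_tfield mulmxDr !mulmxA !mul_row_trmx
    !mul_scalar_mx.
  by rewrite [dot w' (val x)]dotC xw' scale0r addr0 scaleNr.
have L : deriv_along (fun y => nabla (X u) (X v) y - nabla (X v) (X u) y) g x =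
  0.
  have vuv := vector_fieldB oV (lc_field hnabla oV (vX u) (vX v))
    (lc_field hnabla oV (vX v) (vX u)).
  rewrite (deriv_along_ext oV Vx gE ((sFij i j 1).1 _ Vx) (vuv.1 x Vx)).
  rewrite (nabla_tfield u oV Vx (vX v)) (nabla_tfield v oV Vx (vX u)).
  by rewrite [dot u _]dotC [dot v _]dotC xu xv !oppr0 !scale0r subrr derive0.
have := lc_torsion_free hnabla oV (vX u) (vX v) sg Vx.
rewrite L (D2 _ _ xu xv) (D2 _ _ xv xu) [dot u v]dotC.
move: ('D_(_) _ _) ('D_u _ _) ('D_v _ _) => a b c /esym/eqP.
by rewrite subr_eq0 => /eqP/addrI.
Qed.

End LeviCivita.

(** * Covariant derivatives of an almost complex structure *)

(** The matrix computation behind [cov2E]: x is the base point, u, w, y are the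
    values of the three fields, -c1 and -c2 the normal components of the
    derivatives of X and Y, and nY is nabla_Z Y. The matrices D1, D2, Dv, Dn are
    D_X B, D_Z D_X B, D_x B and the derivative of B along nabla_Z X. The two
    hypotheses on D1 trade its normal row and column for B: this is where the
    curvature comes from. *)
Lemma cov2_algebra (R : realType) m (x u w y nY : 'rV[R]_m) (c1 c2 : R)
    (B P D1 D2 Dv Dn : 'M[R]_m) :
  P *m P = P -> x *m P = 0 -> w *m P = w ->
  x *m D1 = - (u *m B) -> D1 *m x^T = - (B *m u^T) -> B *m P = B ->
  (((nY - c2 *: x) *m D1 + y *m (Dn - c1 *: Dv + D2)) *m P +
    y *m D1 *m - (w^T *m x + x^T *m w)) *m P - y *m Dn *m P - nY *m D1 *m P =
  y *m D2 *m P - c1 *: (y *m Dv *m P) + c2 *: (u *m B) + dot (y *m B) u *: w.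
Proof.
move=> PP xP wP xD Dx BP; rewrite [X in X - _ - _]mulmxDl -(mulmxA _ P P) PP.
have -> : y *m D1 *m - (w^T *m x + x^T *m w) *m P = dot (y *m B) u *: w.
  rewrite mulmxN mulNmx mulmxDr mulmxDl !mulmxA -(mulmxA _ x P) xP mulmx0 add0r.
  rewrite -(mulmxA _ w P) wP -(mulmxA y D1) Dx mulmxN mulNmx opprK mulmxA.
  by rewrite mul_row_trmx mul_scalar_mx.
rewrite mulmxDl mulmxBl -scalemxAl xD mulmxBl -scalemxAl mulNmx -(mulmxA u) BP.
rewrite mulmxDr mulmxBr -scalemxAr 2!mulmxDl mulNmx -scalemxAl.
move: (nY *m D1 *m P) (y *m Dn *m P) (y *m Dv *m P) (y *m D2 *m P) (u *m B) =>
  a b c d e.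
move: (dot _ _) => r.
by apply/rowP => k; rewrite !mxE; ring.
Qed.

Section Covariant.
Variables (R : realType) (n : nat) (nabla : vmap R n -> vmap R n -> vmap R n).
Hypothesis hnabla : levi_civita nabla.
Variable J : sphere R n -> 'M[R]_n.+1.
Hypothesis acsJ : almost_complex_structure J.
Implicit Types (x : sphere R n) (U V : set 'rV[R]_n.+1) (X Y Z : vmap R n).

(** The endomorphism J extended by 0 to the normal line. The values of J outside the
    tangent space are arbitrary, those of this field are not. *)
Definition tpart x : 'M[R]_n.+1 := tproj (val x) *m J x *m tproj (val x).

(** J maps tangent vectors to tangent vectors, on which P is the identity. *)
Lemma tpart_mul x v : dot (val x) v = 0 -> v *m tpart x = v *m J x.
Proof.
move=> xv; rewrite !mulmxA tproj_tangent// tproj_tangent//.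
exact: (acsJ.2 x v xv).1.
Qed.

Lemma tproj_mull x : tproj (val x) *m tpart x = tpart x.
Proof. by rewrite /tpart !mulmxA tproj_idem. Qed.

Lemma tpart_sqr x : tpart x *m tpart x = - tproj (val x).
Proof.
apply/row_matrixP => i; rewrite !rowE mulmxN mulmxA.
have t : dot (val x) (delta_mx 0 i *m tproj (val x)) = 0
  by exact: tangent_tproj.
have [tJ JJ] := acsJ.2 x _ t.
by rewrite -{1}tproj_mull mulmxA (tpart_mul t) (tpart_mul tJ).
Qed.

Lemma tproj_mulr x : tpart x *m tproj (val x) = tpart x.
Proof. by rewrite /tpart -!mulmxA tproj_idem. Qed.

Lemma val_tpart x : val x *m tpart x = 0.
Proof. by rewrite /tpart !mulmxA tproj_normal !mul0mx. Qed.

Lemma tpart_val x : tpart x *m (val x)^T = 0.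
Proof. by rewrite -mulmxA -[tproj _ in X in _ *m X]tproj_sym -trmx_mul
  tproj_normal trmx0 mulmx0. Qed.

Lemma smooth_on_tpart : smooth_on setT tpart.
Proof.
move=> x _; have [V [F [oV Vx sF fF]]] := acsJ.1 x I.
exists V, (fun y : 'rV[R]_n.+1 => tproj y *m F y *m tproj y); split=> //.
  move=> k; apply: class_C_mulmx => //; last exact: class_C_tproj.
  by apply: class_C_mulmx => //; exact: class_C_tproj.
by move=> y Vy; rewrite /tpart fF.
Qed.

(** The covariant derivative (nabla_X J) Y. *)
Definition covJ X Y : vmap R n :=
  fun x => nabla X (fun y => Y y *m J y) x - nabla X Y x *m J x.

(** Smoothness is inherited from the connection. *)
Lemma covJ_field U X Y : open U -> vector_field U X -> vector_field U Y ->
  vector_field U (covJ X Y).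
Proof.
move=> oU vX vY; have sJ : smooth_on U J by move=> x _; exact: acsJ.1.
have tJ x v : dot (val x) v = 0 -> dot (val x) (v *m J x) = 0.
  by move=> /(acsJ.2 x v)[].
apply: vector_fieldB => //.
  by apply: (lc_field hnabla) => //; exact: vector_field_mul.
by apply: vector_field_mul => //; exact: (lc_field hnabla).
Qed.

(** The second covariant derivative of J along Z and X, applied to Y. *)
Definition cov2 Z X Y : vmap R n := fun x =>
  nabla Z (covJ X Y) x - covJ (nabla Z X) Y x - covJ X (nabla Z Y) x.

Section Extension.
Variables (V : set 'rV[R]_n.+1) (B : 'rV[R]_n.+1 -> 'M[R]_n.+1).
Hypotheses (oV : open V) (sB : smooth V B).
Hypothesis BE : forall y : sphere R n, V (val y) -> tpart y = B (val y).

(** The derivative of Y B is (D_X Y) B + Y (D_X B). Its first term is cancelled by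
    (nabla_X Y) J, because B kills the normal part of D_X Y. *)
Lemma covJE U X Y x : open U -> U (val x) -> V (val x) ->
  vector_field U X -> vector_field U Y ->
  covJ X Y x = Y x *m 'D_(X x) B (val x) *m tproj (val x).
Proof.
move=> oU Ux Vx vX vY; have tY := vY.1.
have [W [F [oW Wx sF WU fF]]] := smooth_onP oU vY.2 Ux.
have dF := smooth_differentiable sF Wx; have dB := smooth_differentiable sB Vx.
have sJ : smooth_on U J by move=> y _; exact: acsJ.1.
have tJ y v : dot (val y) v = 0 -> dot (val y) (v *m J y) = 0
  by move=> /(acsJ.2 y v)[].
have vYJ := vector_field_mul oU vY sJ tJ.
have sFB : smooth (W `&` V) (fun y => F y *m B y).
  move=> k; apply: class_C_mulmx; first exact: openI.
    by apply: class_C_sub (sF k) => y [].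
  by apply: class_C_sub (sB k) => y [].
have FBE (y : sphere R n) : (W `&` V) (val y) -> Y y *m J y =
  F (val y) *m B (val y).
  by move=> [Wy Vy]; rewrite -(tpart_mul (tY y (WU _ Wy))) (BE Vy) (fF y Wy).
rewrite /covJ (levi_civitaE hnabla oU Ux vX vYJ (openI oW oV) (conj Wx Vx) FBE
  (smooth_differentiable sFB (conj Wx Vx))).
rewrite -(tpart_mul ((lc_field hnabla oU vX vY).1 x Ux)).
rewrite (levi_civitaE hnabla oU Ux vX vY oW Wx fF dF).
rewrite (derive_mulmx (@diff_derivable _ _ _ _ _ (X x) dF)
  (@diff_derivable _ _ _ _ _ (X x) dB)) -(fF x Wx) -(BE Vx).
move: ('D_(X x) F _) ('D_(X x) B _) (Y x) => a b c.
by rewrite mulmxDl -(mulmxA a (tpart x)) tproj_mulr -(mulmxA a _ (tpart x))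
  tproj_mull addrAC subrr add0r.
Qed.

(** The derivative of the identity y B(y) = 0, which holds on the sphere. *)
Lemma val_derive_ext x w : V (val x) -> dot (val x) w = 0 ->
  val x *m 'D_w B (val x) = - (w *m B (val x)).
Proof.
move=> Vx tw; have dB := smooth_differentiable sB Vx.
have sF : smooth V (fun y : 'rV[R]_n.+1 => y *m B y).
  by move=> k; apply: class_C_mulmx => //; exact: class_C_id.
have F0 (y : sphere R n) : V (val y) -> val y *m B (val y) = 0.
  by move=> Vy; rewrite -(BE Vy) val_tpart.
have D0 := derive_tangent oV Vx tw F0 (smooth_differentiable sF Vx)
  (differentiable_cst 0 _).
have E := derive_mulmx (@derivable_id _ _ (val x) w)
  (@diff_derivable _ _ _ _ _ w dB).
have := etrans (esym E) (etrans D0 (derive_cst _ _ _)).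
by rewrite (derive_id (val x) w) => /eqP; rewrite addrC addr_eq0 => /eqP.
Qed.

(** The derivative of the identity B(y) y^T = 0, which holds on the sphere. *)
Lemma derive_ext_val x w : V (val x) -> dot (val x) w = 0 ->
  'D_w B (val x) *m (val x)^T = - (B (val x) *m w^T).
Proof.
move=> Vx tw; have dB := smooth_differentiable sB Vx.
have sF : smooth V (fun y : 'rV[R]_n.+1 => B y *m y^T).
  by move=> k; apply: class_C_mulmx => //; apply: class_C_trmx => //;
    exact: class_C_id.
have F0 (y : sphere R n) : V (val y) -> B (val y) *m (val y)^T = 0.
  by move=> Vy; rewrite -(BE Vy) tpart_val.
have D0 := derive_tangent oV Vx tw F0 (smooth_differentiable sF Vx)
  (differentiable_cst 0 _).
have dT := is_derive_trmx (@derivable_id _ _ (val x) w).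
have E := derive_mulmx (@diff_derivable _ _ _ _ _ w dB)
  (@ex_derive _ _ _ _ _ _ _ dT).
have := etrans (esym E) (etrans D0 (derive_cst _ _ _)).
rewrite (@derive_val _ _ _ _ _ _ _ dT) (derive_id (val x) w).
by move=> /eqP; rewrite addr_eq0 => /eqP.
Qed.

(** Differentiate Y (D_X B) P from [covJE]. The terms other than Y (D_Z D_X B) P are
    the contributions of the normal parts, given by [gauss_formula] for X and Y, and
    of the derivative of P. *)
Lemma cov2E U Z X Y x : open U -> U (val x) -> V (val x) ->
  vector_field U Z -> vector_field U X -> vector_field U Y ->
  cov2 Z X Y x =
    Y x *m 'D_(Z x) ('D_(X x) B) (val x) *m tproj (val x)
    - dot (Z x) (X x) *: (Y x *m 'D_(val x) B (val x) *m tproj (val x))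
    + dot (Z x) (Y x) *: (X x *m B (val x))
    + dot (Y x *m B (val x)) (X x) *: Z x.
Proof.
move=> oU Ux Vx vZ vX vY.
have [W1 [F [oW1 W1x sF W1U fF]]] := smooth_onP oU vX.2 Ux.
have [W2 [G [oW2 W2x sG W2U fG]]] := smooth_onP oU vY.2 Ux.
pose O := W1 `&` W2 `&` V.
have oO : open O by apply: openI => //; exact: openI.
have Ox : O (val x) by [].
have sF' : smooth O F by move=> k; apply: class_C_sub (sF k) => y [[]].
have sG' : smooth O G by move=> k; apply: class_C_sub (sG k) => y [[]].
have sB' : smooth O B by move=> k; apply: class_C_sub (sB k) => y [].
have sD k : class_C k O (fun y => 'D_(F y) B y) :=
  class_C_derive_field_mx k oO sF' sB'.
have sGD k := class_C_mulmx oO (sG' k) (sD k).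
have sH k := class_C_mulmx oO (sGD k) (class_C_tproj k oO).
have HE (y : sphere R n) : O (val y) -> covJ X Y y =
    G (val y) *m 'D_(F (val y)) B (val y) *m tproj (val y).
  move=> [[W1y W2y] Vy]; have Uy := W1U _ W1y.
  by rewrite (covJE oU Uy Vy vX vY) (fF y W1y) (fG y W2y).
have vC := covJ_field oU vX vY.
have vZX := lc_field hnabla oU vZ vX; have vZY := lc_field hnabla oU vZ vY.
rewrite /cov2 (covJE oU Ux Vx vZX vY) (covJE oU Ux Vx vX vZY).
rewrite (levi_civitaE hnabla oU Ux vZ vC oO Ox HE (smooth_differentiable sH
  Ox)).
have dG := @diff_derivable _ _ _ _ _ (Z x) (smooth_differentiable sG W2x).
have dD := @diff_derivable _ _ _ _ _ (Z x) (smooth_differentiable sD Ox).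
have dGD := @diff_derivable _ _ _ _ _ (Z x) (smooth_differentiable sGD Ox).
have dP := derive_tproj (val x) (Z x).
have dB := smooth_differentiable sB Vx.
rewrite (derive_mulmx dGD (@ex_derive _ _ _ _ _ _ _ dP))
  (@derive_val _ _ _ _ _ _ _ dP).
rewrite (derive_mulmx dG dD) (derive_derive_field_mx (Z x) oO Ox sF' sB').
rewrite (gauss_formula hnabla oU Ux vZ vX oW1 W1x W1U sF fF).
rewrite (gauss_formula hnabla oU Ux vZ vY oW2 W2x W2U sG fG).
rewrite -(fF x W1x) -(fG x W2x).
rewrite (derive_dirBZ _ _ _ dB).
have tw := vZ.1 x Ux; have xD := val_derive_ext Vx (vX.1 x Ux).
have Dx := derive_ext_val Vx (vX.1 x Ux).
have BP : B (val x) *m tproj (val x) = B (val x) by rewrite -(BE Vx) tproj_mulr.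
apply: cov2_algebra xD Dx BP; [exact: tproj_idem|exact: tproj_normal|].
exact: tproj_tangent.
Qed.

End Extension.

End Covariant.

(** * Orthonormal frames *)

Section Frames.
Variables (R : realType) (n : nat).
Implicit Types (x : sphere R n).

(** Choose s = 1 or -1 so that x is not the antipode of s E_0. The rotation that
    takes s E_0 to y in the plane of these two vectors maps the basis E_1, ..., E_n
    of the tangent space at s E_0 to an orthonormal basis at y. It depends smoothly
    on y, with the denominator 1 + s y_0. *)
Lemma local_frame_exists x : exists e, local_orthonormal_frame x e.
Proof.
pose s : R := if 0 <= val x 0 0 then 1 else -1.
have s2 : s * s = 1 by rewrite /s; case: ifP => _;
  rewrite ?mulr1// mulrNN mulr1.
pose q (y : 'rV[R]_n.+1) : R^o := 1 + s * y 0 0.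
pose U := [set y : 'rV[R]_n.+1 | 0 < q y].
have cid k V (oV : open V) := (class_C_mxP k id oV).1 (@class_C_id R
  'rV[R]_n.+1 k V).
have cq k V : open V -> class_C k V q.
  move=> oV; apply: class_CD => //; first exact: class_C_cst.
  by apply: class_CM => //; [exact: class_C_cst|exact: cid].
have oU : open U.
  have : continuous q by move=> y; exact: (cq 0 setT openT y I).
  by move=> /continuousP/(_ _ (@open_gt R 0)).
have Ux : U (val x).
  rewrite /U/= /q /s; case: ifP => [x0|/negbT]; first by rewrite mul1r ltr_pwDl.
  by rewrite -ltNge mulN1r => x0; rewrite addr_gt0// oppr_gt0.
pose z (y : 'rV[R]_n.+1) := s *: delta_mx 0 0 + y.
pose e (i : 'I_n) (y : 'rV[R]_n.+1) : 'rV[R]_n.+1 :=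
  delta_mx 0 (lift ord0 i) + (- 1 * (y 0 (lift ord0 i) * (q y)^-1)) *: z y.
have zl (y : sphere R n) : dot (z (val y)) (val y) = q (val y).
  by rewrite dotDl dotZl dotC dot_delta sphereP addrC.
have dl i (y : 'rV[R]_n.+1) : dot (delta_mx 0 (lift ord0 i)) (z y) =
  y 0 (lift ord0 i).
  by rewrite dotC dotDl dotZl dot_delta dot_delta mxE /= mulr0 add0r.
have zz (y : sphere R n) : dot (z (val y)) (z (val y)) = 2 * q (val y).
  rewrite {2}/z dotC dotDl [dot (val y) _]dotC zl dotZl dotC /z dotDl dotZl.
  rewrite dot_delta dot_delta mxE !eqxx /q mulrDr mulrA s2.
  by rewrite mulr1n !mul1r mulr2n mulrDl mul1r; ring.
exists (fun i y => e i (val y)), U; split=> //.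
- move=> i; split=> [y Uy|].
    have qy : q (val y) != 0 by rewrite gt_eqF.
    rewrite dotC /e dotDl dotZl zl dotC dot_delta.
    by rewrite mulN1r mulNr mulfVK// subrr.
  apply: (@smooth_on_ext _ _ _ U U _ (e i)) => // k.
  apply: class_CD => //; first exact: class_C_cst.
  apply: class_CZ => //.
    apply: class_CM => //; first exact: class_C_cst.
    apply: class_CM => //; first exact: cid.
    apply: class_CV => //; last exact: cq.
    by move=> y Uy; rewrite gt_eqF.
  by apply: class_CD => //; [exact: class_C_cst|exact: class_C_id].
- move=> y Uy i j; have qy : q (val y) != 0 by rewrite gt_eqF.
  have dotE2 (a b c : 'rV[R]_n.+1) (k l : R) : dot (a + k *: c) (b + l *: c) =
      dot a b + l * dot a c + k * dot b c + k * l * dot c c.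
    rewrite dotDl dotZl !dotDr !dotZr (dotC c b).
    by ring.
  rewrite /e dotE2 zz !dl dot_delta mxE eqxx (inj_eq (@lift_inj _ ord0))
    /= eq_sym.
  by field.
Qed.

Lemma frameP x : local_orthonormal_frame x (frame x).
Proof.
exact: (@xgetPex _ (fun _ _ => 0) [set e | local_orthonormal_frame x e]
  (local_frame_exists x)).
Qed.

(** The rows x, e_1, ..., e_n form an orthogonal matrix Q, and Q^T Q = 1 as well. *)
Lemma frame_complete x (e : 'I_n -> 'rV[R]_n.+1) :
  (forall i, dot (val x) (e i) = 0) ->
  (forall i j, dot (e i) (e j) = (i == j)%:R) ->
  \sum_i (e i)^T *m e i = tproj (val x).
Proof.
move=> xe ee; pose M := \matrix_(i < n) e i.
pose Q : 'M[R]_(1 + n, n.+1) := col_mx (val x) M.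
have QQ : Q *m Q^T = 1%:M.
  apply: (etrans _ (esym (@scalar_mx_block R 1 n 1))).
  rewrite /Q tr_col_mx mul_col_row mul_row_trmx sphereP; congr block_mx.
  - apply/rowP => i; rewrite !mxE -[RHS](xe i) /dot; apply: eq_bigr => k _.
    by rewrite !mxE.
  - apply/colP => i; rewrite !mxE -[RHS](xe i) dotC /dot; apply: eq_bigr => k _.
    by rewrite !mxE.
  - apply/matrixP => i j; rewrite !mxE -[RHS]ee /dot; apply: eq_bigr => k _.
    by rewrite !mxE.
have : Q^T *m Q = 1%:M :> 'M[R]_n.+1 by exact: (@mulmx1C _ n.+1 Q Q^T QQ).
rewrite /Q tr_col_mx mul_row_col => E.
have {}E : M^T *m M = 1%:M - (val x)^T *m val x
  by rewrite -E addrAC subrr add0r.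
rewrite /tproj -E; apply/matrixP => a b; rewrite summxE !mxE;
  apply: eq_bigr => i _.
by rewrite !mxE big_ord1 !mxE.
Qed.

Lemma tfield_complete (x : sphere R n) :
  \sum_b (tfield (delta_mx 0 b) x)^T *m tfield (delta_mx 0 b) x = tproj (val x).
Proof.
rewrite -{1}tproj_idem -{1}[tproj _ in RHS]tproj_sym -{2}[tproj (val x)]mul1mx.
have D : (1%:M : 'M[R]_n.+1) = \sum_b (delta_mx (0 : 'I_1) b)^T *m delta_mx (0 :
  'I_1) b.
  by rewrite mx1_sum_delta; apply: eq_bigr => b _;
    rewrite trmx_delta mul_delta_mx.
rewrite D mulmx_suml mulmx_sumr; apply: eq_bigr => b _.
by rewrite /tfield trmx_mul !mulmxA.
Qed.

End Frames.

Section SumFrames.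
Variables (R : realType) (m : nat).

(** The contraction of a linear family depends on e only through the sum of the
    e^T e. By this lemma an orthonormal frame can be replaced by [tfield]s. *)
Lemma sum_mul_derive (I : finType) (e : I -> 'rV[R]_m) p
    (F : 'rV[R]_m -> 'M[R]_(m, p)) a :
  differentiable F a ->
  \sum_i e i *m 'D_(e i) F a =
  \sum_b row b (\sum_i (e i)^T *m e i) *m 'D_(delta_mx 0 b) F a.
Proof.
move=> dF; under eq_bigr do rewrite (derive_dir_delta _ dF) mulmx_sumr.
rewrite exchange_big /=; apply: eq_bigr => b _.
move: ('D_(delta_mx 0 b) F a) => L.
rewrite linear_sum mulmx_suml; apply: eq_bigr => i _ /=.
rewrite row_mul -scalemxAr scalemxAl; congr (_ *m _).
by apply/rowP => j; rewrite !mxE big_ord1 !mxE.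
Qed.

(** For an orthonormal basis of the tangent space, the expansion of u in it. *)
Lemma sum_dot_scale (I : finType) (e : I -> 'rV[R]_m) u :
  \sum_i dot u (e i) *: e i = u *m \sum_i (e i)^T *m e i.
Proof.
rewrite mulmx_sumr; apply: eq_bigr => i _.
by rewrite mulmxA mul_row_trmx mul_scalar_mx.
Qed.

(** For an orthonormal basis of the tangent space, the trace of A in it. *)
Lemma sum_dot_mul (I : finType) (e : I -> 'rV[R]_m) A :
  \sum_i dot (e i *m A) (e i) = \tr (A *m \sum_i (e i)^T *m e i).
Proof.
rewrite mulmx_sumr raddf_sum; apply: eq_bigr => i _ /=.
by rewrite dotE mulmxA mxtrace_mulC mulmxA /mxtrace big_ord1.
Qed.

End SumFrames.

(** * The Hodge Laplacian of an endomorphism field *)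

Section Hodge.
Variables (R : realType) (n : nat) (nabla : vmap R n -> vmap R n -> vmap R n).
Hypothesis hnabla : levi_civita nabla.
Variable J : sphere R n -> 'M[R]_n.+1.
Hypothesis acsJ : almost_complex_structure J.
Implicit Types (x : sphere R n) (U V : set 'rV[R]_n.+1) (X Y Z : vmap R n).

Local Notation covJ := (covJ nabla J).
Local Notation cov2 := (cov2 nabla J).
Local Notation eps b := (tfield (delta_mx 0 b)).

Lemma d_endo_formE (Xs : 'I_2 -> vmap R n) x :
  d_form nabla (endo_form J) Xs x =
  covJ (Xs ord0) (Xs ord_max) x - covJ (Xs ord_max) (Xs ord0) x.
Proof.
rewrite /d_form big_ord_recl big_ord1 /nabla_form !big_ord1 /endo_form /= expr0
  expr1.
rewrite scale1r scaleN1r /covJ.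
have -> : lift ord0 ord0 = ord_max :> 'I_2 by apply/val_inj.
by have -> : lift ord_max ord0 = ord0 :> 'I_2 by apply/val_inj.
Qed.

Lemma codiff_endo_formE (Xs : 'I_0 -> vmap R n) x :
  codiff nabla (endo_form J) Xs x = - \sum_i covJ (frame x i) (frame x i) x.
Proof.
rewrite /codiff; congr (- _); apply: eq_bigr => i _.
have c0 : cons_field (frame x i) Xs ord0 = frame x i
  by rewrite /cons_field unlift_none.
by rewrite /nabla_form big_ord1 /endo_form /= c0.
Qed.

Lemma codiff_d_endo_formE (Xs : 'I_1 -> vmap R n) x :
  vector_field setT (Xs ord0) ->
  codiff nabla (d_form nabla (endo_form J)) Xs x =
  - \sum_i (cov2 (frame x i) (frame x i) (Xs ord0) x
            - cov2 (frame x i) (Xs ord0) (frame x i) x).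
Proof.
move=> vX; have [W [oW Wx vE _]] := frameP x.
have vXW : vector_field W (Xs ord0) by apply: vector_field_sub vX.
rewrite /codiff; congr (- _); apply: eq_bigr => i _.
set e := frame x i; set X := Xs ord0.
rewrite /nabla_form big_ord_recl big_ord1 !d_endo_formE /=.
have c0 : cons_field e Xs ord0 = e by rewrite /cons_field unlift_none.
have c1 : cons_field e Xs ord_max = X.
  rewrite /cons_field; case: unliftP => [j _|/(congr1 val)//].
  by rewrite (ord1 j).
rewrite c0 c1.
have -> : d_form nabla (endo_form J) (cons_field e Xs) =
  fun y => covJ e X y - covJ X e y.
  by rewrite funeqE => y; rewrite d_endo_formE c0 c1.
have veX := covJ_field hnabla acsJ oW (vE i) vXW.
have vXe := covJ_field hnabla acsJ oW vXW (vE i).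
rewrite (nablaB hnabla oW Wx (vE i) veX vXe) /cov2.
rewrite -/e -/X.
move: (nabla e _ x) (nabla e _ x) (covJ _ X x) (covJ X _ x) (covJ _ e x)
  (covJ e _ x) => a b c d f g.
by apply/rowP => k; rewrite !mxE; ring.
Qed.

(** The divergence of J does not depend on the frame. Here the frame at x was chosen
    separately at each point; the right-hand side is a fixed smooth expression. *)
Lemma sum_covJ_frame x :
  \sum_i covJ (frame x i) (frame x i) x = \sum_b covJ (eps b) (eps b) x.
Proof.
have [V [B [oV Vx sB _ BE]]] := smooth_onP openT (smooth_on_tpart acsJ) (I :
  setT (val x)).
have [W [oW Wx vE eE]] := frameP x.
have dB := smooth_differentiable sB Vx.
have -> : \sum_i covJ (frame x i) (frame x i) x =
    (\sum_i frame x i x *m 'D_(frame x i x) B (val x)) *m tproj (val x).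
  rewrite mulmx_suml; apply: eq_bigr => i _.
  by rewrite (covJE hnabla acsJ oV sB BE oW Wx Vx (vE i) (vE i)).
have -> : \sum_b covJ (eps b) (eps b) x =
    (\sum_b eps b x *m 'D_(eps b x) B (val x)) *m tproj (val x).
  rewrite mulmx_suml; apply: eq_bigr => b _; have vb :=
    vector_field_tfield W (delta_mx 0 b).
  by rewrite (covJE hnabla acsJ oV sB BE oW Wx Vx vb vb).
have F1 := frame_complete (fun i => (vE i).1 x Wx) (fun i j => eE x Wx i j).
congr (_ *m _); apply: (etrans (sum_mul_derive (fun i => frame x i x) dB)).
apply: (etrans _ (esym (sum_mul_derive (fun b => eps b x) dB))).
by rewrite tfield_complete F1.
Qed.

(** The covariant derivative of the field number b along X is -x_b X, and the
    terms that come from it sum up to the projection of x, that is, to 0. *)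
Lemma nabla_divergence U X x : open U -> U (val x) -> vector_field U X ->
  nabla X (fun y => - \sum_b covJ (eps b) (eps b) y) x =
  - \sum_b cov2 X (eps b) (eps b) x.
Proof.
move=> oU Ux vX.
have [V [B [oV Vx sB _ BE]]] := smooth_onP openT (smooth_on_tpart acsJ) (I :
  setT (val x)).
have dB := smooth_differentiable sB Vx.
have ve b : vector_field U (eps b) by exact: vector_field_tfield.
have [_ ->] := nabla_sumN hnabla (index_enum 'I_n.+1) oU Ux vX (fun b =>
  covJ_field hnabla acsJ oU (ve b) (ve b)).
have S0 : \sum_b covJ (nabla X (eps b)) (eps b) x = 0.
  transitivity (- (\sum_b dot (delta_mx 0 b) (val x) *: eps b x) *m 'D_(X x)
    B (val x) *m tproj (val x)).
    rewrite -mulmxA mulNmx mulmx_suml -sumrN; apply: eq_bigr => b _.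
    have vb := lc_field hnabla oU vX (ve b).
    rewrite (covJE hnabla acsJ oV sB BE oU Ux Vx vb (ve b))
      (nabla_tfield hnabla _ oU Ux vX).
    by rewrite (derive_dirZ _ _ dB) -scalemxAr -scalemxAl scaleNr -scalemxAl
      mulmxA.
  rewrite (_ : \sum_b _ = 0) ?oppr0 ?mul0mx//.
  transitivity ((\sum_b val x 0 b *: (delta_mx 0 b :
    'rV[R]_n.+1)) *m tproj (val x)).
    rewrite mulmx_suml; apply: eq_bigr => b _.
    by rewrite dotC dot_delta /tfield scalemxAl.
  by rewrite -row_sum_delta tproj_normal.
have S1 : \sum_b covJ (eps b) (nabla X (eps b)) x = 0.
  transitivity (- X x *m 'D_(\sum_b val x 0 b *: eps b x) B (val x)
    *m tproj (val x)).
    rewrite (derive_dir_sum _ _ dB) mulmx_sumr mulmx_suml;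
      apply: eq_bigr => b _.
    have vb := lc_field hnabla oU vX (ve b).
    rewrite (covJE hnabla acsJ oV sB BE oU Ux Vx (ve b) vb)
      (nabla_tfield hnabla _ oU Ux vX).
    rewrite (derive_dirZ _ _ dB) dotC dot_delta.
    by rewrite -scalemxAr -!scalemxAl scaleNr !mulNmx scalerN.
  rewrite (_ : \sum_b _ = 0) ?derive0 ?mulmx0 ?mul0mx//.
  transitivity ((\sum_b val x 0 b *: (delta_mx 0 b :
    'rV[R]_n.+1)) *m tproj (val x)).
    by rewrite mulmx_suml; apply: eq_bigr => b _; rewrite /tfield scalemxAl.
  by rewrite -row_sum_delta tproj_normal.
have -> : \sum_b cov2 X (eps b) (eps b) x = \sum_b nabla X (covJ (eps b)
  (eps b)) x
    - \sum_b covJ (nabla X (eps b)) (eps b) x - \sum_b covJ (eps b)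
      (nabla X (eps b)) x.
  by rewrite -2!sumrB.
by rewrite S0 S1 !subr0.
Qed.

(** The first sum is d (delta J), the second one delta (d J). *)
Lemma hodge_laplacian_endo (Xs : 'I_1 -> vmap R n) x :
  vector_field setT (Xs ord0) ->
  hodge_laplacian nabla (endo_form J) Xs x =
  - \sum_b cov2 (Xs ord0) (eps b) (eps b) x
  - \sum_i (cov2 (frame x i) (frame x i) (Xs ord0) x
            - cov2 (frame x i) (Xs ord0) (frame x i) x).
Proof.
move=> vX; rewrite /hodge_laplacian (codiff_d_endo_formE _ vX); congr (_ + _).
rewrite -(nabla_divergence openT I vX)
  /d_form big_ord1 expr0 scale1r /nabla_form big_ord0 subr0.
congr (nabla _ _ x); rewrite funeqE => y.
by rewrite codiff_endo_formE sum_covJ_frame.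
Qed.

End Hodge.

(** * The Weitzenboeck formula *)

(** Sum [cov2E] over the frames in [hodge_laplacian_endo]. The two sums of terms
    D_u D_e B and D_e D_u B cancel by [derive_comm], which leaves the curvature. *)
Lemma weitzenboeck_formula (R : realType) n
    (nabla : vmap R n -> vmap R n -> vmap R n) (J : sphere R n -> 'M[R]_n.+1)
    V (B : 'rV[R]_n.+1 -> 'M[R]_n.+1) (x : sphere R n) u :
  levi_civita nabla -> harmonic_complex_structure nabla J -> open V ->
    smooth V B ->
  (forall y : sphere R n, V (val y) -> tpart J y = B (val y)) -> V (val x) ->
  dot (val x) u = 0 ->
  let e i := frame x i x in
  u *m (\sum_i 'D_(e i) ('D_(e i) B) (val x)) *m tproj (val x) =
  n%:R *: (u *m 'D_(val x) B (val x) *m tproj (val x)) +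
  (n%:R - 3) *: (u *m B (val x)) + u *m (B (val x))^T - \tr (B (val x)) *: u.
Proof.
move=> hnabla harmJ oV sB BE Vx xu e; have acsJ := harmJ.1.
have [W [oW Wx vE eE]] := frameP x.
have e1 := fun i j => eE x Wx i j.
have te i := (vE i).1 x Wx.
have F1 : \sum_i (e i)^T *m e i = tproj (val x) by exact: frame_complete te e1.
have BP : B (val x) *m tproj (val x) = B (val x) by rewrite -(BE x Vx)
  tproj_mulr.
have PB : tproj (val x) *m B (val x) = B (val x) by rewrite -(BE x Vx)
  tproj_mull.
have vX : vector_field setT (tfield u) by exact: vector_field_tfield.
have Xx : tfield u x = u by exact: tproj_tangent.
have vXW : vector_field W (tfield u) by exact: vector_field_tfield.
have vb b : vector_field W (tfield (delta_mx 0 b))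
  by exact: vector_field_tfield.
have cov Z X Y (vZ : vector_field W Z) (vX' : vector_field W X) (vY :
  vector_field W Y) :=
  cov2E hnabla acsJ oV sB BE oW Wx Vx vZ vX' vY.
have dDu : differentiable ('D_u B) (val x) by exact: ((sB 2).2 u).1.
have dB : differentiable B (val x) by exact: (sB 1).1.
have uP : u *m tproj (val x) = u by exact: tproj_tangent.
have uE : u = \sum_i dot u (e i) *: e i by rewrite sum_dot_scale F1.
pose P := tproj (val x); pose Dx := 'D_(val x) B (val x).
(* S is the term that the two mixed traces have in common. *)
pose S := \sum_b row b P *m 'D_(delta_mx 0 b) ('D_u B) (val x).
(* The trace of nabla^2 J, from delta d J. *)
have C1 : \sum_i cov2 nabla J (frame x i) (frame x i) (tfield u) x =
    u *m (\sum_i 'D_(e i) ('D_(e i) B) (val x)) *m P - n%:R *: (u *m Dx *m P)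
    + u *m B (val x) + u *m B (val x).
  rewrite (eq_bigr _ (fun i _ => cov _ _ _ (vE i) (vE i) vXW))
    !big_split /= sumrN.
  rewrite Xx -/e; congr (_ - _ + _ + _).
  - by rewrite mulmx_sumr mulmx_suml.
  - rewrite (eq_bigr (fun=> u *m Dx *m P)) => [|i _];
    last by rewrite e1 eqxx scale1r.
    by rewrite sumr_const card_ord scaler_nat.
  - rewrite [in RHS]uE mulmx_suml; apply: eq_bigr => i _.
    by rewrite -scalemxAl [dot u _]dotC.
  - by rewrite sum_dot_scale F1 -mulmxA BP.
(* The sum of the (nabla^2_{e,u} J) e, from delta d J. *)
have C2 : \sum_i cov2 nabla J (frame x i) (tfield u) (frame x i) x =
    S *m P - u *m Dx *m P + n%:R *: (u *m B (val x)) + u *m (B (val x))^T.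
  rewrite (eq_bigr _ (fun i _ => cov _ _ _ (vE i) vXW (vE i)))
    !big_split /= sumrN.
  rewrite Xx -/e; congr (_ - _ + _ + _).
  - rewrite /S /P -F1 -(sum_mul_derive _ dDu) mulmx_suml.
    by apply: eq_bigr => i _.
  - rewrite [in RHS]uE !mulmx_suml; apply: eq_bigr => i _.
    by rewrite -!scalemxAl [dot u _]dotC.
  - rewrite (eq_bigr (fun=> u *m B (val x))) => [|i _];
    last by rewrite e1 eqxx scale1r.
    by rewrite sumr_const card_ord scaler_nat.
  - rewrite (eq_bigr (fun i => dot (u *m (B (val x))^T) (e i) *: e i)).
      by rewrite sum_dot_scale F1 -mulmxA -[tproj _]tproj_sym -trmx_mul PB.
    by move=> i _; rewrite dot_mull dotC.
(* The sum of the (nabla^2_{u,e} J) e, from d delta J. *)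
have C3 : \sum_b cov2 nabla J (tfield u) (tfield (delta_mx 0 b))
  (tfield (delta_mx 0 b)) x =
    S *m P - u *m Dx *m P + u *m B (val x) + \tr (B (val x)) *: u.
  pose eps b := tfield (delta_mx 0 b) x.
  have xeps b : dot (val x) (eps b) = 0 by exact: tangent_tproj.
  have F2 : \sum_b (eps b)^T *m eps b = tproj (val x) by exact: tfield_complete.
  have uE2 : u = \sum_b dot u (eps b) *: eps b by rewrite sum_dot_scale F2.
  rewrite (eq_bigr _ (fun b _ => cov _ _ _ vXW (vb b)
    (vb b))) !big_split /= sumrN.
  rewrite Xx -/eps; congr (_ - _ + _ + _).
  - rewrite /S /P -F2 -(sum_mul_derive _ dDu) F2 mulmx_suml;
    apply: eq_bigr => b _.
    by rewrite (derive_comm hnabla oV Vx sB BE xu (xeps b)).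
  - rewrite [in RHS]uE2 !mulmx_suml; apply: eq_bigr => b _.
    by rewrite -!scalemxAl.
  - rewrite [in RHS]uE2 mulmx_suml; apply: eq_bigr => b _.
    by rewrite -scalemxAl.
  - by rewrite -scaler_suml sum_dot_mul F2 BP.
have := harmJ.2 (fun=> tfield u) (fun=> vX) x.
move=> /(etrans (esym (hodge_laplacian_endo (Xs := fun=> tfield u)
  hnabla acsJ x vX))).
have C12 := etrans (congr2 (fun a b => a - b) (esym C1) (esym C2))
  (esym (sumrB _ _ _ _)).
move=> /(etrans (congr2 (fun a b => - a - b) (esym C3) C12)).
rewrite -/P -/Dx.
move: (u *m _ *m P) (u *m Dx *m P) (u *m B _) (u *m _^T) (S *m P) (\tr _) =>
  a b c d f t H.
apply/eqP; rewrite -subr_eq0 -oppr_eq0 -[X in _ == X]H; apply/eqP.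
by apply/rowP => k; rewrite !mxE; ring.
Qed.

(** * The trace of a complex structure *)

(** Factor E = C Q through its image; then Q C is the identity of that image. *)
Lemma mxtrace_idempotent (F : fieldType) m (E : 'M[F]_m) :
  E *m E = E -> \tr E = (\rank E)%:R.
Proof.
move=> EE; pose C := col_base E; pose Q := row_base E.
have CQ : C *m Q = E by exact: mulmx_base.
have QC : Q *m C = 1%:M.
  have fC : row_full C by exact: col_base_full.
  have fQ : row_free Q by exact: row_base_free.
  apply: (row_full_inj fC); apply: (row_free_inj fQ).
  by rewrite mulmx1 (mulmxA C Q C) CQ -(mulmxA E C Q) CQ EE.
by rewrite -{1}CQ mxtrace_mulC QC mxtrace1.
Qed.

(** Over the complex numbers (P - i A) / 2 is idempotent: it projects onto an
    eigenspace of A. Its trace is its rank, so it is real, and the imaginary part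
    of this trace is - tr(A) / 2. *)
Lemma mxtrace_complex_structure (R : rcfType) m (A P : 'M[R]_m) :
  P *m P = P -> P *m A = A -> A *m P = A -> A *m A = - P -> \tr A = 0.
Proof.
move=> PP PA AP AA.
pose f : {rmorphism R -> R[i]} := real_complex R.
pose E : 'M[R[i]]_m := 2^-1 *: (map_mx f P - 'i%C *: map_mx f A).
have ii : 'i%C * 'i%C = -1 :> R[i] by rewrite -expr2 sqr_i.
have EE : E *m E = E.
  rewrite /E -scalemxAl -scalemxAr scalerA mulmxBl !mulmxBr -!scalemxAl
    -!scalemxAr.
  rewrite scalerA -!map_mxM PP PA AP AA ii map_mxN scaleN1r opprK.
  by apply/matrixP => k l; rewrite !mxE; field.
have := mxtrace_idempotent EE.
rewrite /E mxtraceZ raddfB /= mxtraceZ !trace_map_mx =>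
  /(congr1 (fun z : R[i] => 2 * z)).
rewrite mulrA divff ?pnatr_eq0// mul1r -natrM -(rmorph_nat f) =>
  /(congr1 (@complex.Im R)) /=.
by rewrite mul0r mul1r !add0r => /eqP; rewrite oppr_eq0 => /eqP.
Qed.

(** * The maximum principle on the sphere *)

Section MaximumPrinciple.
Variable R : realType.

(** If l were positive, then h' would be positive on some ]0, d[ since h' 0 = 0, and
    h would exceed h 0 there by the mean value theorem. *)
Lemma second_derivative_le0 (h h' : R^o -> R^o) (l : R) :
  (\forall t \near (0 : R^o), is_derive (t : R^o) (1 : R^o) h (h' t)) ->
  is_derive (0 : R^o) (1 : R^o) h' l ->
  (\forall t \near (0 : R^o), h t <= h 0) -> l <= 0.
Proof.
move=> dh dh' mh; rewrite leNgt; apply/negP => l0.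
have [r /= r0 H] : exists2 r, 0 < r & forall t : R, `|t| < r ->
  is_derive (t : R^o) (1 : R^o) h (h' t) /\ h t <= h 0.
  have [r /= r0 H] := (nbhs_ballP _ _).1 (filterI dh mh).
  by exists r => // t tr; apply: (H t); rewrite /ball /= sub0r normrN.
have inr t : t \in `]-r, r[%R -> `|t| < r by rewrite in_itv /= ltr_norml.
have h'0 : h' 0 = 0.
  have D0 := (H 0 _).1; rewrite normr0 in D0; have {}D0 := D0 r0.
  rewrite -(@derive_val _ _ _ _ _ _ _ D0).
  have := @derive1_at_max R h (- r) r 0 _ _ _ _.
  case.
  - by rewrite -subr_ge0 opprK addr_ge0// ltW.
  - by move=> t /inr/H[D _]; exact: ex_derive.
  - by rewrite in_itv /= r0 oppr_lt0 r0.
  - by move=> t /inr/H[].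
  by move=> _ ->.
have [d d0 D] : exists2 d, 0 < d & forall t, 0 < t -> t < d -> 0 < h' t.
  have c : (fun s : R => s^-1 *: (h' (s *: 1 + 0) - h' 0)) @ 0^' --> l.
    have := @ex_derive _ _ _ _ _ _ _ dh'; rewrite /derivable.
    by rewrite -(@derive_val _ _ _ _ _ _ _ dh').
  have nh := cvgr_gt l c 0 l0.
  have {nh} := nh (dnbhs_filter _); rewrite near_withinE =>
    /nbhs_ballP[d /= d0 Hd]; exists d => // t t0 td.
  have : 0 < t^-1 * (h' (t *: 1 + 0) - h' 0).
    by apply: (Hd t); rewrite ?gt_eqF// /ball/= sub0r normrN gtr0_norm.
  by rewrite h'0 subr0 addr0 [_ *: 1]mulr1 pmulr_rgt0 ?invr_gt0.
pose t := Num.min r d / 2.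
have m0 : 0 < Num.min r d by rewrite lt_min r0 d0.
have t0 : 0 < t by rewrite divr_gt0.
have tm : t < Num.min r d by rewrite /t; lra.
have tr : t < r by apply: lt_le_trans tm _; rewrite ge_min lexx.
have td : t < d by apply: lt_le_trans tm _; rewrite ge_min lexx orbT.
have Dh s : 0 <= s -> s <= t -> is_derive (s : R^o) (1 : R^o) h (h' s).
  by move=> s0 st; apply: (H s _).1; rewrite ger0_norm// (le_lt_trans st).
have [||c] := @MVT R h h' 0 t t0.
- by move=> s; rewrite in_itv /= => /andP[s0 st]; apply: Dh; exact: ltW.
- apply: derivable_within_continuous => s; rewrite in_itv /= => /andP[s0 st].
  by have ? := Dh s s0 st; exact: ex_derive.
rewrite in_itv /= => /andP[c0 ct] E.
have := (H t _).2; rewrite gtr0_norm// => /(_ tr).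
by rewrite -subr_le0 E subr0 leNgt mulr_gt0// D// (lt_trans ct).
Qed.

Variable n : nat.
Implicit Types (x : sphere R n) (V : set 'rV[R]_n.+1).

(** Differentiate phi twice along the great circle cos t x + sin t e, whose
    acceleration at t = 0 is -x. *)
Lemma sphere_second_derivative_le0 V (phi : 'rV[R]_n.+1 -> R^o) x e :
  open V -> V (val x) -> smooth V phi ->
  (forall y : sphere R n, V (val y) -> phi (val y) <= phi (val x)) ->
  dot (val x) e = 0 -> dot e e = 1 ->
  'D_e ('D_e phi) (val x) - 'D_(val x) phi (val x) <= 0.
Proof.
move=> oV Vx sphi mphi xe ee.
pose g (t : R^o) : 'rV[R]_n.+1 := cos t *: val x + sin t *: e.
have g0 : g 0 = val x by rewrite /g cos0 sin0 scale1r scale0r addr0.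
have dg t : is_derive t (1 : R^o) g (- sin t *: val x + cos t *: e).
  have D j : is_derive t (1 : R^o) (fun s => g s 0 j :
    R^o) ((- sin t *: val x + cos t *: e) 0 j).
    have -> : (fun s => g s 0 j : R^o) = (@cos R : R^o ->
      R^o) * (fun=> val x 0 j : R^o)
        + (@sin R : R^o -> R^o) * (fun=> e 0 j : R^o).
      by rewrite funeqE => s; rewrite /g !mxE.
    have D := is_deriveD (is_deriveM (is_derive_cos (t :
      R)) (is_derive_cst (val x 0 j : R^o) (t : R^o) 1))
      (is_deriveM (is_derive_sin (t : R)) (is_derive_cst (e 0 j : R^o) (t :
        R^o) 1)).
    apply: is_derive_eq D _; rewrite !mxE !scaler0 !add0r /GRing.scale /=.
    by ring.
  have d : derivable g t (1 : R^o).
    by apply/derivable_mxP => i j; rewrite (ord1 i);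
      exact: (@ex_derive _ _ _ _ _ _ _ (D j)).
  apply: DeriveDef => //; apply/rowP => j.
  by rewrite -(derive_entry _ _ d) (@derive_val _ _ _ _ _ _ _ (D j)).
have cg : g @ 0 --> val x.
  rewrite -g0; apply: differentiable_continuous; apply/derivable1_diffP.
  exact: (@ex_derive _ _ _ _ _ _ _ (dg 0)).
have nV : \forall t \near (0 : R^o), V (g t) by apply: cg;
  exact: open_nbhs_nbhs.
pose h : R^o -> R^o := phi \o g.
pose h' (t : R^o) : R^o := - sin t * 'D_(val x) phi (g t)
  + cos t * 'D_e phi (g t).
apply: (@second_derivative_le0 h h').
- apply: filterS nV => t Vt; have dphi : differentiable phi (g t)
  by exact: (sphi 1).1.
  have D := is_derive_comp (@ex_derive _ _ _ _ _ _ _ (dg t)) dphi.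
  apply: is_derive_eq D _; rewrite (@derive_val _ _ _ _ _ _ _ (dg t)).
  by rewrite (derive_dirD _ _ dphi) !(derive_dirZ _ _ dphi).
- have dw w : is_derive (0 : R^o) 1 ('D_w phi \o g) ('D_e ('D_w phi) (val x)).
    have dphi : differentiable ('D_w phi) (g 0) by rewrite g0;
      exact: ((sphi 2).2 w).1.
    have D := is_derive_comp (@ex_derive _ _ _ _ _ _ _ (dg 0)) dphi.
    apply: is_derive_eq D _; rewrite (@derive_val _ _ _ _ _ _ _ (dg 0)) g0.
    by rewrite sin0 cos0 oppr0 scale0r add0r scale1r.
  have dx := dw (val x); have de := dw e.
  have ds := is_deriveN (is_derive_sin (0 : R)).
  have D := is_deriveD (is_deriveM ds dx) (is_deriveM (is_derive_cos (0 :
    R)) de).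
  apply: is_derive_eq D _; rewrite /= g0 /GRing.scale /= sin0 cos0.
  by move: ('D_e ('D_(val x) phi) _) ('D_e ('D_e phi) _) ('D_(val x) phi _)
    ('D_e phi _) => a b c f; rewrite fctE sin0; ring.
- apply: filterS nV => t Vt; rewrite /h /= g0.
  have gS : dot (g t) (g t) == 1.
    apply/eqP; rewrite /g !dotDl !dotZl ![dot _ (_ + _)]dotC !dotDl !dotZl.
    rewrite sphereP ee [dot e (val x)]dotC xe -[RHS](cos2Dsin2 t) !expr2; ring.
  exact: (mphi (exist _ (g t) gS)).
Qed.

(** The function is turned into one on the compact set of unit vectors of R^(n+1),
    extended arbitrarily. *)
Lemma sphere_maximum (f : sphere R n -> R) :
  (forall x : sphere R n, exists V (F : 'rV[R]_n.+1 -> R^o),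
    [/\ open V, V (val x), {for val x, continuous F} &
      forall y : sphere R n, V (val y) -> f y = F (val y)]) ->
  exists x : sphere R n, forall y, f y <= f x.
Proof.
move=> cf; pose A := [set a : 'rV[R]_n.+1 | dot a a == 1].
have x0P : dot (delta_mx 0 0) (delta_mx 0 0 : 'rV[R]_n.+1) == 1.
  by rewrite dot_delta mxE !eqxx.
pose x0 : sphere R n := exist _ (delta_mx 0 0) x0P.
pose g (a : 'rV[R]_n.+1) : R := f (insubd x0 a).
have Av a (Aa : A a) : val (insubd x0 a) = a by rewrite val_insubd Aa.
have gE (y : sphere R n) : g (val y) = f y by rewrite /g valKd.
have cA : compact A.
  apply: bounded_closed_compact.
    exists 1; split=> // M M1 a /= /eqP a1.
    rewrite [leLHS]/Num.Def.normr /= mx_normrE; apply: bigmax_le;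
      first exact: ltW (lt_trans ltr01 M1).
    move=> [i j] _ /=; rewrite (ord1 i); apply: le_trans (ltW M1).
    rewrite -(@expr_le1 _ 2)// -normrX ger0_norm ?sqr_ge0// -a1 /dot (bigD1
      j)//= expr2 lerDl.
    by apply: sumr_ge0 => k _; rewrite -expr2 sqr_ge0.
  have cq : continuous (fun a : 'rV[R]_n.+1 => dot a a : R^o).
    by move=> a; exact: (class_C_dot openT (@class_C_id _ _ 0 setT)
      (@class_C_id _ _ 0 setT) a I).
  have := closed_comp (fun a _ => cq a) (@closed_eq R 1).
  by rewrite /A; congr closed; apply/seteqP; split=> a /= /eqP.
have [||a /set_mem Aa amax] := @EVT_max_rV R n.+1 g A _ cA.
- by exists (val x0); exact: (valP x0).
- apply/subspace_continuousP => a Aa; pose x : sphere R n := exist _ a Aa.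
  have [V [F [oV Vx cF fF]]] := cf x.
  suff : g @ within A (nbhs a) --> g a by [].
  have -> : g a = F a by exact: etrans (gE x) (fF x Vx).
  have cF' : F @ within A (nbhs a) --> F a by apply: cvg_within_filter;
    exact: cF.
  apply: cvg_trans cF'; apply: near_eq_cvg; rewrite near_withinE.
  apply: filterS (open_nbhs_nbhs (conj oV Vx)) => b Vb Ab.
  by rewrite /g fF ?(Av b Ab).
exists (insubd x0 a) => y; rewrite -!gE (Av a Aa); apply: amax.
by apply/mem_set; exact: (valP y).
Qed.

End MaximumPrinciple.

(** * Harmonic complex structures *)

(** Letting u run over the standard basis turns the hypothesis into an identity
    between matrices compressed by P. The compression does not affect traces
    against B^T, as B = P B P. *)
Lemma mxip_tangent (R : comNzRingType) m (P B M D : 'M[R]_m) (c d : R) :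
  P^T = P -> P *m B = B -> B *m P = B ->
  (forall u : 'rV_m, u *m P *m M *m P =
     c *: (u *m P *m D *m P) + d *: (u *m P *m B) + u *m P *m B^T) ->
  \tr (M *m B^T) =
    c * \tr (D *m B^T) + d * \tr (B *m B^T) + \tr (B^T *m B^T).
Proof.
move=> PT PB BP H.
have PBT : P *m B^T = B^T by rewrite -{1}PT -trmx_mul BP.
have BTP : B^T *m P = B^T by rewrite -{1}PT -trmx_mul PB.
have E : P *m M *m P = c *: (P *m D *m P) + d *: B + B^T.
  apply/row_matrixP => i; rewrite !rowE !mulmxDr -!scalemxAr.
  have := H (delta_mx 0 i).
  by rewrite -!(mulmxA (delta_mx 0 i)) PB PBT !mulmxA.
have ipP A : \tr (P *m A *m P *m B^T) = \tr (A *m B^T).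
  by rewrite -mulmxA PBT -mulmxA mxtrace_mulC -mulmxA BTP.
have := congr1 (fun A => \tr (A *m B^T)) E.
by rewrite /= ipP !mulmxDl -!scalemxAl !mxtraceD !mxtraceZ ipP.
Qed.

(** At a maximum x of |B|^2, the maximum principle says that the inner product of B
    with the sum of the D_e D_e B minus n D_x B is at most 0. By
    [weitzenboeck_formula] it equals (n - 3) |B|^2 + <B^T, B>. As |B|^2 + <B^T, B>
    is half of |B + B^T|^2, this is at least (n - 4) |B|^2 > 0. *)
Lemma no_harmonic_complex_structure (R : realType) n
    (nabla : vmap R n -> vmap R n -> vmap R n) (hnabla : levi_civita nabla) :
  (4 < n)%N ->
  ~ exists J : sphere R n -> 'M[R]_n.+1, harmonic_complex_structure nabla J.
Proof.
move=> n4 [J harmJ]; have acsJ := harmJ.1.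
have ext (y : sphere R n) := smooth_onP openT (smooth_on_tpart acsJ) (I :
  setT (val y)).
have sphi V (B : 'rV[R]_n.+1 -> 'M[R]_n.+1) : open V -> smooth V B ->
    smooth V (fun y => \tr (B y *m (B y)^T) : R^o).
  move=> oV sB k; have cBB := class_C_mulmx oV (sB k) (class_C_trmx oV (sB k)).
  rewrite (_ : (fun=> _) = fun y => \sum_(i <- enum 'I_n.+1)
    (B y *m (B y)^T) i i : R^o).
    by apply: class_C_sum => // i; exact: ((class_C_mxP _ _ oV).1 cBB).
  by rewrite funeqE => y; rewrite big_enum.
have [x xmax] : exists x : sphere R n, forall y,
    \tr (tpart J y *m (tpart J y)^T) <= \tr (tpart J x *m (tpart J x)^T).
  apply: (@sphere_maximum _ _ (fun y => \tr (tpart J y *m (tpart J y)^T))) => y.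
  have [V [B [oV Vy sB _ BE]]] := ext y.
  exists V, (fun y => \tr (B y *m (B y)^T) : R^o); split;
    [exact: oV|exact: Vy| |].
    exact/differentiable_continuous/(smooth_differentiable (sphi V B oV sB) Vy).
  by move=> z Vz; rewrite (BE z Vz).
have [V [B [oV Vx sB _ BE]]] := ext x.
pose e i := frame x i x.
have [W [oW Wx vE eE]] := frameP x.
(* The nonnegative a will be |D_e B|^2. *)
have slack (a b c : R) : 0 <= a -> (b + a) *+ 2 - c *+ 2 <= 0 -> b - c <= 0.
  by rewrite !mulr2n; lra.
have max i : \tr ('D_(e i) ('D_(e i) B) (val x) *m (B (val x))^T)
    - \tr ('D_(val x) B (val x) *m (B (val x))^T) <= 0.
  pose phi (y : 'rV[R]_n.+1) : R^o := \tr (B y *m (B y)^T).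
  have dw w y : V y -> is_derive y w phi (\tr ('D_w B y *m (B y)^T) *+ 2).
    move=> Vy; have dB := @diff_derivable _ _ _ _ _ w (smooth_differentiable sB
      Vy).
    apply: is_derive_eq (is_derive_mxip dB dB) _.
    by rewrite mulr2n -[in X in _ + X]mxtrace_tr trmx_mul trmxK.
  have mphi (y : sphere R n) : V (val y) -> phi (val y) <= phi (val x).
    by move=> Vy; rewrite /phi -BE// -BE.
  have := sphere_second_derivative_le0 oV Vx (sphi V B oV sB)
    mphi ((vE i).1 x Wx).
  rewrite eE// eqxx => /(_ erefl).
  have -> : 'D_(val x) phi (val x) = \tr ('D_(val x) B (val x) *m (B (val x))^T)
    *+ 2.
    exact: (@derive_val _ _ _ _ _ _ _ (dw (val x) _ Vx)).
  have -> : 'D_(e i) ('D_(e i) phi) (val x) =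
     (\tr ('D_(e i) ('D_(e i) B) (val x) *m (B (val x))^T) +
      \tr ('D_(e i) B (val x) *m ('D_(e i) B (val x))^T)) *+ 2.
    pose g (y : 'rV[R]_n.+1) : R^o := \tr ('D_(e i) B y *m (B y)^T).
    have dB := @diff_derivable _ _ _ _ _ (e i) (smooth_differentiable sB Vx).
    have dDB := @diff_derivable _ _ _ _ _ (e i) (((sB 2).2 (e i)).1 _ Vx).
    have Dg := is_derive_mxip dDB dB.
    have Dgg : is_derive (val x) (e i) (g + g) _ := is_deriveD Dg Dg.
    rewrite mulr2n; apply: (etrans _ (@derive_val _ _ _ _ _ _ _ Dgg)).
    apply: near_eq_derive; apply: filterS (open_nbhs_nbhs (conj oV Vx)) => y Vy.
    by apply: (etrans (@derive_val _ _ _ _ _ _ _ (dw (e i) y Vy)));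
      rewrite mulr2n.
  exact: slack (mxip_ge0 ('D_(e i) B (val x))).
have BP : B (val x) *m tproj (val x) = B (val x) by rewrite -(BE x Vx)
  tproj_mulr.
have PB : tproj (val x) *m B (val x) = B (val x) by rewrite -(BE x Vx)
  tproj_mull.
have BB : B (val x) *m B (val x) = - tproj (val x)
  by rewrite -(BE x Vx) (tpart_sqr acsJ).
have trB : \tr (B (val x)) = 0 by exact: mxtrace_complex_structure (tproj_idem
  x) PB BP BB.
have bo := weitzenboeck_formula hnabla harmJ oV sB BE Vx.
have E := mxip_tangent (tproj_sym _) PB BP (fun u =>
  etrans (bo _ (tangent_tproj x u))
  (etrans (congr1 (fun t => _ - t *: (u *m tproj (val x))) trB)
    (etrans (congr1 (fun v => _ - v) (scale0r _)) (subr0 _)))).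
have ipM : \tr ((\sum_i 'D_(e i) ('D_(e i) B) (val x)) *m (B (val x))^T)
    - n%:R * \tr ('D_(val x) B (val x) *m (B (val x))^T) <= 0.
  have S : \sum_(i < n) (\tr ('D_(e i) ('D_(e i) B) (val x) *m (B (val x))^T)
      - \tr ('D_(val x) B (val x) *m (B (val x))^T)) =
      \tr ((\sum_i 'D_(e i) ('D_(e i) B) (val x)) *m (B (val x))^T)
      - n%:R * \tr ('D_(val x) B (val x) *m (B (val x))^T).
    rewrite sumrB sumr_const card_ord [RHS]addrC mulr_natl [RHS]addrC;
      congr (_ - _).
    by rewrite mulmx_suml raddf_sum.
  by rewrite -S; apply: sumr_le0 => i _; exact: max.
have pos := mxip_ge0 (B (val x)).
(* Half of |B + B^T|^2. *)
have sym : 0 <= \tr (B (val x) *m (B (val x))^T)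
  + \tr ((B (val x))^T *m (B (val x))^T).
  have := mxip_ge0 (B (val x) + (B (val x))^T).
  rewrite linearD /= trmxK mulmxDl !mulmxDr !mxtraceD.
  rewrite [\tr (_^T *m B _)]mxtrace_mulC -[\tr (B _ *m B _)]mxtrace_tr trmx_mul.
  by lra.
have B0 : \tr (B (val x) *m (B (val x))^T) != 0.
  apply/eqP => /mxip_eq0 B0; move: BB; rewrite B0 mul0mx => /esym/eqP;
    rewrite oppr_eq0 => /eqP P0.
  have i : 'I_n by exact: (Ordinal (ltn_trans (isT : (0 < 4)%N) n4)).
  have := tproj_tangent ((vE i).1 x Wx); rewrite P0 mulmx0 => e0.
  have := eE x Wx i i; rewrite -e0 eqxx dotE mul0mx mxE => /esym/eqP.
  by rewrite oner_eq0.
have n5 : 5 <= n%:R :> R by rewrite (ler_nat _ 5 n).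
move: B0 pos sym ipM E.
move: (\tr ((\sum_i _) *m _)) (\tr ('D_(_) _ _ *m _)) (\tr (B _ *m _))
  (\tr (_^T *m _)) => a b c d.
move=> c0 c1 cd ab E; have {c0 c1} c0 : 0 < c by rewrite lt_def c0.
have : 0 <= (n%:R - 5) * c by rewrite mulr_ge0 ?subr_ge0// ltW.
by move: (n%:R) ab E => r ab E; nra.
Qed.

Theorem theorem3p6 (R : realType)
    (nabla : vmap R 6 -> vmap R 6 -> vmap R 6)
    (hnabla : levi_civita nabla) :
  ~ exists J : sphere R 6 -> 'M[R]_7, harmonic_complex_structure nabla J.
Proof. exact: (no_harmonic_complex_structure hnabla). Qed.
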